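(* Let $p\in\{3,5,7,11\}$, let $\mathbb{K}$ be a field of characteristic $p$, let $n,m$ be integers with $1<n\le p+1$ and $1\le m\le p$, and let $SL^{n,m}$ be the Lie superalgebra over $\mathbb{K}$ defined in the context. Then the cohomology space $\mathrm{H}^2(SL^{n,m};SL^{n,m})$ is: (i) trivial, if $m<p$ and $n<p+1$; (ii) $1$-dimensional, if $m=p$ and $n<p+1$; it is generated by the class of the 2-cocycle $c_1$; (iii) $1$-dimensional, if $m<p$ and $n=p+1$; it is generated by the class of the 2-cocycle $c_2$; (iv) $2$-dimensional, if $m=p$ and $n=p+1$; it is generated by the classes of the 2-cocycles $c_1$ and $c_2$. Here $c_1$ (when $m=p$) and $c_2$ (when $n=p+1$) are the bilinear maps given on pairs $(A,B)$ of basis elements by $$c_1(X_1,Y_p)=Y_1,\quad c_1(Y_p,X_1)=-Y_1,\quad c_1(A,B)=0\ \text{otherwise};$$ $$c_2(X_1,X_{p+1})=X_2,\quad c_2(X_{p+1},X_1)=-X_2,\quad c_2(A,B)=0\ \text{otherwise}.$$ With respect to the grading $\deg X_r=r$, $\deg Y_s=n+s$, $\deg T_l=0$ of $SL^{n,m}$, both $c_1$ and $c_2$ have degree $-p$.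
   Context: The Lie superalgebra $SL^{n,m}$. Its even part has basis $X_1,\dots,X_n,T_1,T_2,T_3$ and its odd part has basis $Y_1,\dots,Y_m$. The only non-zero brackets of basis elements (up to the super skew-symmetry $[X,Y]=-(-1)^{|X||Y|}[Y,X]$) are - $[X_1,X_i]=X_{i+1}$ for $2\le i\le n-1$; $[X_1,Y_j]=Y_{j+1}$ for $1\le j\le m-1$; - $[T_1,X_i]=iX_i$ for $1\le i\le n$; $[T_1,Y_j]=jY_j$ for $1\le j\le m$; - $[T_2,X_i]=X_i$ for $2\le i\le n$; $[T_3,Y_j]=Y_j$ for $1\le j\le m$. In particular the bracket of any two odd elements is zero. Integer coefficients are read in $\mathbb{K}$. Cohomology. For a Lie superalgebra $\mathfrak g=\mathfrak g_{\bar 0}\oplus\mathfrak g_{\bar 1}$ and a $\mathfrak g$-module $A=A_{\bar 0}\oplus A_{\bar 1}$, the $q$-cochains are $C^q(\mathfrak g;A)=\bigoplus_{q_0+q_1=q}\mathrm{Hom}(\wedge^{q_0}\mathfrak g_{\bar 0}\otimes S^{q_1}\mathfrak g_{\bar 1},A)$ (linear maps of both parities). The differential is $$\begin{aligned}(dc)(g_1,\dots,g_{q_0},h_1,\dots,h_{q_1})={}&\sum_{1\le s<t\le q_0}(-1)^{s+t-1}c([g_s,g_t],g_1,\dots,\hat g_s,\dots,\hat g_t,\dots,g_{q_0},h_1,\dots,h_{q_1})\\&+\sum_{s=1}^{q_0}\sum_{t=1}^{q_1}(-1)^{s-1}c(g_1,\dots,\hat g_s,\dots,g_{q_0},[g_s,h_t],h_1,\dots,\hat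 h_t,\dots,h_{q_1})\\&+\sum_{1\le s<t\le q_1}c([h_s,h_t],g_1,\dots,g_{q_0},h_1,\dots,\hat h_s,\dots,\hat h_t,\dots,h_{q_1})\\&+\sum_{s=1}^{q_0}(-1)^s g_s\cdot c(g_1,\dots,\hat g_s,\dots,g_{q_0},h_1,\dots,h_{q_1})\\&+(-1)^{q_0-1}\sum_{s=1}^{q_1}h_s\cdot c(g_1,\dots,g_{q_0},h_1,\dots,\hat h_s,\dots,h_{q_1})\end{aligned}$$ for $g_i\in\mathfrak g_{\bar 0}$, $h_j\in\mathfrak g_{\bar 1}$. It satisfies $d\circ d=0$, and $\mathrm{H}^q(\mathfrak g;A)=Z^q(\mathfrak g;A)/B^q(\mathfrak g;A)$ (cocycles modulo coboundaries). $\mathrm{H}^q(\mathfrak g;\mathfrak g)$ denotes cohomology with coefficients in the adjoint module. A bilinear map is homogeneous of degree $d$ if it sends a pair of homogeneous elements of degrees $a,b$ to an element of degree $a+b+d$. *)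

(* Defs.v *)
From HB Require Import structures.
From mathcomp Require Import all_boot all_order all_algebra.
From mathcomp Require Import boolp functions.
From mathcomp Require Import zify ring.

Set Implicit Arguments.
Unset Strict Implicit.
Unset Printing Implicit Defensive.

Import GRing.Theory.
Local Open Scope ring_scope.

(* A superspace is a product V0 * V1; [hom b x] says that x is homogeneous of
   parity b (false = even, true = odd). *)
Definition hom (K : fieldType) (V0 V1 : lmodType K) (b : bool)
  (x : V0 * V1) : Prop := if b then x.1 = 0 else x.2 = 0.

(* The last two axioms follow from the others when 6 is invertible in K; they
   are the usual additional requirements in characteristics 2 and 3. *)
Record lieSuperalgebra (K : fieldType) := LieSuperalgebra {
  ev : lmodType K;
  od : lmodType K;
  sbr : ev * od -> ev * od -> ev * od;
  sbr_linearl : forall a x y z, sbr (a *: x + y) z = a *: sbr x z + sbr y z;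
  sbr_linearr : forall a z x y, sbr z (a *: x + y) = a *: sbr z x + sbr z y;
  sbr_hom : forall a b x y, hom a x -> hom b y -> hom (a (+) b) (sbr x y);
  sbr_skew : forall a b x y, hom a x -> hom b y ->
    sbr x y = - ((-1) ^+ (a && b) *: sbr y x);
  sbr_jacobi : forall a b c x y z, hom a x -> hom b y -> hom c z ->
    sbr x (sbr y z) = sbr (sbr x y) z + (-1) ^+ (a && b) *: sbr y (sbr x z);
  sbr_even : forall x, hom false x -> sbr x x = 0;
  sbr_odd : forall x, hom true x -> sbr x (sbr x x) = 0
}.

Definition carrier (K : fieldType) (g : lieSuperalgebra K) : lmodType K :=
  (ev g * od g)%type.

Record superModule (K : fieldType) (g : lieSuperalgebra K) := SuperModule {
  mEv : lmodType K;
  mOd : lmodType K;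
  act : carrier g -> mEv * mOd -> mEv * mOd;
  act_linearl : forall a x y v, act (a *: x + y) v = a *: act x v + act y v;
  act_linearr : forall a x v w, act x (a *: v + w) = a *: act x v + act x w;
  act_hom : forall a b x v, hom a x -> hom b v -> hom (a (+) b) (act x v);
  act_sbr : forall a b x y v, hom a x -> hom b y ->
    act (sbr x y) v = act x (act y v) - (-1) ^+ (a && b) *: act y (act x v)
}.

Definition mcarrier (K : fieldType) (g : lieSuperalgebra K)
  (A : superModule g) : lmodType K := (mEv A * mOd A)%type.

Section Adjoint.
Variables (K : fieldType) (g : lieSuperalgebra K).

Lemma adjoint_sbr a b (x y v : ev g * od g) : hom a x -> hom b y ->
  sbr (sbr x y) v =
  sbr x (sbr y v) - (-1) ^+ (a && b) *: sbr y (sbr x v).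
Proof.
move=> hx hy.
have sbrD z u w : sbr (z : ev g * od g) (u + w) = sbr z u + sbr z w.
  by rewrite -[u]scale1r sbr_linearr !scale1r.
have h c z : hom c z -> sbr (sbr x y) z =
    sbr x (sbr y z) - (-1) ^+ (a && b) *: sbr y (sbr x z).
  by move=> hz; rewrite (sbr_jacobi hx hy hz) addrK.
have -> : v = (v.1, 0) + (0, v.2).
  by case: v => v0 v1; congr (_, _); rewrite /= ?addr0 ?add0r.
rewrite !sbrD (h false (v.1, 0)) // (h true (0, v.2)) //.
by rewrite scalerDr opprD addrACA.
Qed.

Definition adjoint : superModule g :=
  @SuperModule K g (ev g) (od g) (@sbr K g) (@sbr_linearl K g)
    (@sbr_linearr K g) (@sbr_hom K g) adjoint_sbr.

End Adjoint.

Definition del (T : Type) (i : nat) (s : seq T) : seq T :=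
  take i s ++ drop i.+1 s.

Section Cohomology.
Variables (K : fieldType) (g : lieSuperalgebra K) (A : superModule g).

Definition einj (x : ev g) : carrier g := (x, 0).
Definition oinj (y : od g) : carrier g := (0, y).

(* A q-cochain is a family of maps, one for each (q0, q1) with q0 + q1 = q,
   alternating in q0 even and symmetric in q1 odd arguments.  The whole family
   is encoded as one function of two lists of arguments, which is zero on the
   pairs of lists whose lengths do not add up to q. *)
Definition precochain : Type := seq (ev g) -> seq (od g) -> mcarrier A.

Definition isCochain (q : nat) (c : precochain) : Prop :=
  [/\ forall gs hs, (size gs + size hs)%N != q -> c gs hs = 0,
      forall a x y gs1 gs2 hs,
        c (gs1 ++ (a *: x + y) :: gs2) hs =
        a *: c (gs1 ++ x :: gs2) hs + c (gs1 ++ y :: gs2) hs,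
      forall a x y gs hs1 hs2,
        c gs (hs1 ++ (a *: x + y) :: hs2) =
        a *: c gs (hs1 ++ x :: hs2) + c gs (hs1 ++ y :: hs2),
      forall x gs1 gs2 gs3 hs, c (gs1 ++ x :: gs2 ++ x :: gs3) hs = 0
    & forall gs hs hs', perm_eq hs hs' -> c gs hs = c gs hs'].

(* Positions are counted from 0: s and t stand for s - 1 and t - 1 in the
   usual formula, which accounts for the shifts in the exponents of -1. *)
Definition differential (c : precochain) : precochain := fun gs hs =>
  let q0 := size gs in let q1 := size hs in
  let g_ s := einj (nth 0 gs s) in let h_ s := oinj (nth 0 hs s) in
  \sum_(t < q0) \sum_(s < t)
     (-1) ^+ (s + t).+1 *: c ((sbr (g_ s) (g_ t)).1 :: del s (del t gs)) hs
  + \sum_(s < q0) \sum_(t < q1)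
     (-1) ^+ s *: c (del s gs) ((sbr (g_ s) (h_ t)).2 :: del t hs)
  + \sum_(t < q1) \sum_(s < t)
     c ((sbr (h_ s) (h_ t)).1 :: gs) (del s (del t hs))
  + \sum_(s < q0) (-1) ^+ s.+1 *: act (g_ s) (c (del s gs) hs)
  + (-1) ^+ q0.+1 *: \sum_(s < q1) act (h_ s) (c gs (del s hs)).

Definition isCocycle (q : nat) (c : precochain) : Prop :=
  isCochain q c /\ differential c = 0.

Definition isCoboundary (q : nat) (c : precochain) : Prop :=
  if q is q'.+1 then exists2 b, isCochain q' b & c = differential b
  else c = 0.

Lemma pre0E gs hs : (0 : precochain) gs hs = 0.
Proof. by []. Qed.

Lemma preE a (c c' : precochain) gs hs :
  (a *: c + c') gs hs = a *: c gs hs + c' gs hs.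
Proof. by []. Qed.

Lemma isCochain0 q : isCochain q 0.
Proof.
by split=> *; rewrite ?pre0E ?scaler0 ?addr0.
Qed.

Lemma isCochainD q a c c' :
  isCochain q c -> isCochain q c' -> isCochain q (a *: c + c').
Proof.
case=> c1 c2 c3 c4 c5 [d1 d2 d3 d4 d5]; split.
- by move=> gs hs e; rewrite !preE c1 ?d1 // scaler0 addr0.
- move=> b x y gs1 gs2 hs; rewrite !preE c2 d2 !scalerDr !scalerA addrACA.
  by rewrite (mulrC a).
- move=> b x y gs1 gs2 hs; rewrite !preE c3 d3 !scalerDr !scalerA addrACA.
  by rewrite (mulrC a).
- by move=> x gs1 gs2 gs3 hs; rewrite !preE c4 d4 scaler0 addr0.
- by move=> gs hs hs' e; rewrite !preE (c5 _ _ _ e) (d5 _ _ _ e).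
Qed.

Lemma differentialD a c c' :
  differential (a *: c + c') = a *: differential c + differential c'.
Proof.
apply/funext => gs; apply/funext => hs; rewrite preE /differential.
rewrite !scalerDr.
have add5 (x1 x2 x3 x4 x5 y1 y2 y3 y4 y5 : mcarrier A) :
  (x1 + x2 + x3 + x4 + x5) + (y1 + y2 + y3 + y4 + y5)
  = (x1 + y1) + (x2 + y2) + (x3 + y3) + (x4 + y4) + (x5 + y5).
  by rewrite addrACA; congr (_ + _); rewrite addrACA; congr (_ + _);
     rewrite addrACA; congr (_ + _); rewrite addrACA.
rewrite add5; congr (_ + _ + _ + _ + _).
- rewrite scaler_sumr -big_split; apply: eq_bigr => t _.
  rewrite scaler_sumr -big_split; apply: eq_bigr => s _ /=.
  by rewrite scalerDr !scalerA mulrC.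
- rewrite scaler_sumr -big_split; apply: eq_bigr => s _.
  rewrite scaler_sumr -big_split; apply: eq_bigr => t _ /=.
  by rewrite scalerDr !scalerA mulrC.
- rewrite scaler_sumr -big_split; apply: eq_bigr => t _.
  by rewrite scaler_sumr -big_split.
- rewrite scaler_sumr -big_split; apply: eq_bigr => s _ /=.
  by rewrite act_linearr scalerDr !scalerA mulrC.
- rewrite scalerA mulrC -scalerA -scalerDr; congr (_ *: _).
  rewrite scaler_sumr -big_split; apply: eq_bigr => s _ /=.
  by rewrite act_linearr.
Qed.

Lemma differential0 : differential 0 = 0.
Proof.
have := differentialD 1 0 0; rewrite !scale1r !addr0 => /esym/eqP.
by rewrite -subr_eq0 addrK => /eqP.
Qed.

Variable q : nat.

Definition Zpred : {pred precochain} := fun c => `[< isCocycle q c >].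

Lemma Zpred_submod : submod_closed Zpred.
Proof.
split; first by apply/asboolP; split; [exact: isCochain0|exact: differential0].
move=> a c c' /asboolP[hc dc] /asboolP[hc' dc']; apply/asboolP; split.
  exact: isCochainD.
by rewrite differentialD dc dc' scaler0 addr0.
Qed.

HB.instance Definition _ :=
  GRing.isSubmodClosed.Build K precochain Zpred Zpred_submod.

Definition cocycle : Type := {c : precochain | c \in Zpred}.
HB.instance Definition _ := SubChoice.on cocycle.
HB.instance Definition _ := [SubChoice_isSubLmodule of cocycle by <:].

Definition Bpred : {pred cocycle} :=
  fun z => `[< isCoboundary q (val z) >].

Lemma Bpred_submod : submod_closed Bpred.
Proof.
split.
  apply/asboolP; rewrite raddf0 /=; case: q => //= q'.
  by exists 0; [exact: isCochain0|rewrite differential0].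
move=> a z z' /asboolP hz /asboolP hz'; apply/asboolP.
rewrite linearP; move: hz hz'; case: q => /= [->->|q'].
  by rewrite scaler0 addr0.
move=> [b hb ->] [b' hb' ->]; exists (a *: b + b'); first exact: isCochainD.
by rewrite differentialD.
Qed.

HB.instance Definition _ :=
  GRing.isSubmodClosed.Build K cocycle Bpred Bpred_submod.

(* Since d o d = 0, every coboundary is a cocycle, so that Bpred is all of B^q
   and this is the quotient space Z^q / B^q. *)
Definition cohomology : Type := Quotient.quot Bpred.
HB.instance Definition _ := GRing.Zmodule.on cohomology.

Definition cohomClass (z : cocycle) : cohomology := (\pi z)%qT.

Definition cohom_scale (a : K) (x : cohomology) : cohomology :=
  cohomClass (a *: repr x).

Lemma cohomClassE (z z' : cocycle) :
  (cohomClass z == cohomClass z') = (z - z' \in Bpred).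
Proof. by rewrite Quotient.idealrBE. Qed.

Lemma cohomClassD (z z' : cocycle) :
  cohomClass (z + z') = cohomClass z + cohomClass z'.
Proof. exact: (raddfD (\pi_(Quotient.quot Bpred))%qT). Qed.

Lemma cohomClassK x : cohomClass (repr x) = x.
Proof. exact: reprK. Qed.

Lemma cohomClassZ a (z : cocycle) :
  cohomClass (a *: z) = cohom_scale a (cohomClass z).
Proof.
apply/eqP; rewrite cohomClassE -scalerBr; apply: rpredZ.
by rewrite -cohomClassE cohomClassK.
Qed.

Lemma cohom_scaleA a b x :
  cohom_scale a (cohom_scale b x) = cohom_scale (a * b) x.
Proof. by rewrite -[x]cohomClassK -!cohomClassZ scalerA. Qed.

Lemma cohom_scale1 : left_id 1 cohom_scale.
Proof. by move=> x; rewrite -[x]cohomClassK -!cohomClassZ scale1r. Qed.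

Lemma cohom_scaleDr : right_distributive cohom_scale +%R.
Proof.
move=> a x y; rewrite -[x]cohomClassK -[y]cohomClassK.
by rewrite -cohomClassD -!cohomClassZ -cohomClassD scalerDr.
Qed.

Lemma cohom_scaleDl x : {morph cohom_scale^~ x : a b / a + b}.
Proof.
move=> a b; rewrite -[x]cohomClassK.
by rewrite -!cohomClassZ -cohomClassD scalerDl.
Qed.

HB.instance Definition _ := GRing.Zmodule_isLmodule.Build K cohomology
  cohom_scaleA cohom_scale1 cohom_scaleDr cohom_scaleDl.

Lemma cohomClassP a (z z' : cocycle) :
  cohomClass (a *: z + z') = a *: cohomClass z + cohomClass z'.
Proof. by rewrite cohomClassD cohomClassZ. Qed.

(* The 2-cochain of a super skew-symmetric bilinear map f. *)
Definition cochain2 (f : carrier g -> carrier g -> mcarrier A) : precochain :=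
  fun gs hs => match gs, hs with
  | [:: x; y], [::] => f (einj x) (einj y)
  | [:: x], [:: h] => f (einj x) (oinj h)
  | [::], [:: h; k] => f (oinj h) (oinj k)
  | _, _ => 0
  end.

End Cohomology.

Arguments cochain2 {K g} A f.

Definition hasDim (K : fieldType) (V : lmodType K) (d : nat) : Prop :=
  inhabited (Vector.axiom d V).

(* GX i, GT l, GY j are the names of the basis elements X_i, T_l, Y_j. *)
Inductive gen := GX of nat | GT of nat | GY of nat.

Definition gen_eqb (a b : gen) : bool := match a, b with
  | GX i, GX j | GT i, GT j | GY i, GY j => i == j
  | _, _ => false
  end.

Lemma gen_eqP : Equality.axiom gen_eqb.
Proof.
by move=> [i|i|i] [j|j|j] /=; try by [constructor];
  apply: (iffP eqP) => [->|[]].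
Qed.

HB.instance Definition _ := hasDecEq.Build gen gen_eqP.

Section SL.
Variables (K : fieldType) (n m : nat).

Definition slIndex : finType := (('I_n + 'I_3) + 'I_m)%type.

Definition slName (b : slIndex) : gen := match b with
  | inl (inl i) => GX i.+1
  | inl (inr l) => GT l.+1
  | inr j => GY j.+1
  end.

Definition slEven : lmodType K := {ffun 'I_n + 'I_3 -> K^o}.
Definition slOdd : lmodType K := {ffun 'I_m -> K^o}.
Definition slSpace : lmodType K := (slEven * slOdd)%type.

Definition slCoord (b : slIndex) (u : slSpace) : K :=
  match b with inl e => u.1 e | inr o => u.2 o end.

(* The basis element named x, or 0 if x is not the name of one. *)
Definition slVec (x : gen) : slSpace :=
  ([ffun e => (slName (inl e) == x)%:R], [ffun o => (slName (inr o) == x)%:R]).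

Notation eX i := (slVec (GX i)).
Notation eT i := (slVec (GT i)).
Notation eY i := (slVec (GY i)).

Definition bilinearExt (f : gen -> gen -> slSpace) (u v : slSpace) : slSpace :=
  \sum_a \sum_b (slCoord a u * slCoord b v) *: f (slName a) (slName b).

Definition slBracket0 (a b : gen) : slSpace := match a, b with
  | GX 1, GX i => if (2 <= i <= n.-1)%N then eX i.+1 else 0
  | GX 1, GY j => if (1 <= j <= m.-1)%N then eY j.+1 else 0
  | GT 1, GX i => i%:R *: eX i
  | GT 1, GY j => j%:R *: eY j
  | GT 2, GX i => if (2 <= i)%N then eX i else 0
  | GT 3, GY j => eY j
  | _, _ => 0
  end.

(* slBracket0 gives each non-zero bracket in one order only; the other order
   is its opposite, because no bracket of two odd elements is involved. *)
Definition slBracket : slSpace -> slSpace -> slSpace :=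
  bilinearExt (fun a b => slBracket0 a b - slBracket0 b a).

Lemma coordP u v : (forall b, slCoord b u = slCoord b v) -> u = v.
Proof.
case: u v => [u0 u1] [v0 v1] h; congr (_, _); apply/ffunP => b.
  exact: (h (inl b)).
exact: (h (inr b)).
Qed.

Lemma coordL b a u v : slCoord b (a *: u + v) = a * slCoord b u + slCoord b v.
Proof. by case: b => b; rewrite /= !ffunE. Qed.

Lemma coord0 b : slCoord b 0 = 0.
Proof. by case: b => b; rewrite /= !ffunE. Qed.

Lemma coordD b u v : slCoord b (u + v) = slCoord b u + slCoord b v.
Proof. by rewrite -[u]scale1r coordL mul1r scale1r. Qed.

Lemma coordZ b a u : slCoord b (a *: u) = a * slCoord b u.
Proof. by rewrite -[a *: u]addr0 coordL coord0 addr0. Qed.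

Lemma coordB b u v : slCoord b (u - v) = slCoord b u - slCoord b v.
Proof. by rewrite -scaleN1r addrC coordL mulN1r addrC. Qed.

Lemma coord_sum b (I : finType) (F : I -> slSpace) :
  slCoord b (\sum_i F i) = \sum_i slCoord b (F i).
Proof. exact: (big_morph _ (coordD b) (coord0 b)). Qed.

Lemma coord_vec b x : slCoord b (slVec x) = (slName b == x)%:R.
Proof. by case: b => b; rewrite /= !ffunE. Qed.

Lemma bilinearExt_linearl f a x y z :
  bilinearExt f (a *: x + y) z = a *: bilinearExt f x z + bilinearExt f y z.
Proof.
rewrite scaler_sumr -big_split; apply: eq_bigr => b _.
rewrite scaler_sumr -big_split; apply: eq_bigr => c _ /=.
by rewrite scalerA -scalerDl coordL mulrA -mulrDl.
Qed.

Lemma bilinearExt_linearr f a z x y :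
  bilinearExt f z (a *: x + y) = a *: bilinearExt f z x + bilinearExt f z y.
Proof.
rewrite scaler_sumr -big_split; apply: eq_bigr => b _.
rewrite scaler_sumr -big_split; apply: eq_bigr => c _ /=.
by rewrite scalerA -scalerDl coordL mulrCA -mulrDr.
Qed.

Lemma name_inj : injective slName.
Proof. by move=> [[a|a]|a] [[b|b]|b] //= [/val_inj ->]. Qed.

Lemma bilinearExt_basis f a b :
  bilinearExt f (slVec (slName a)) (slVec (slName b)) = f (slName a) (slName b).
Proof.
rewrite /bilinearExt (bigD1 a) //= (bigD1 b) //= !coord_vec !eqxx mulr1.
rewrite scale1r !big1 ?addr0 // => [c hc|c hc].
  rewrite big1 // => d _; rewrite !coord_vec (inj_eq name_inj).
  by rewrite (negbTE hc) mul0r scale0r.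
by rewrite !coord_vec (inj_eq name_inj) (negbTE hc) mulr0 scale0r.
Qed.

Lemma slBracketE u v : slBracket u v =
  bilinearExt slBracket0 u v - bilinearExt slBracket0 v u.
Proof.
rewrite /slBracket /bilinearExt [X in _ - X]exchange_big -sumrB.
apply: eq_bigr => a _; rewrite -sumrB; apply: eq_bigr => b _.
by rewrite scalerBr [slCoord b v * _]mulrC.
Qed.

Lemma slBracket_skew u v : slBracket u v = - slBracket v u.
Proof. by rewrite !slBracketE opprB. Qed.

(* The coordinate of u at the basis element named x, or 0 if there is none. *)
Definition slCoef (x : gen) (u : slSpace) : K :=
  \sum_b (slName b == x)%:R * slCoord b u.

Lemma coef_name b u : slCoef (slName b) u = slCoord b u.
Proof.
rewrite /slCoef (bigD1 b) //= eqxx mul1r big1 ?addr0 // => c /negbTE hc.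
by rewrite (inj_eq name_inj) hc mul0r.
Qed.

Lemma coef_out x u : (forall b, slName b != x) -> slCoef x u = 0.
Proof.
by move=> h; rewrite /slCoef big1 // => b _; rewrite (negbTE (h b)) mul0r.
Qed.

Lemma sum_coef2 x y (r : K) u v :
  \sum_a \sum_b slCoord a u * slCoord b v *
    ((slName a == x)%:R * (slName b == y)%:R * r)
  = slCoef x u * slCoef y v * r.
Proof.
rewrite /slCoef big_distrlr mulr_suml; apply: eq_bigr => a _.
rewrite mulr_suml; apply: eq_bigr => b _ /=.
by rewrite mulrA [X in X * r]mulrACA; congr (_ * _ * _); rewrite mulrC.
Qed.

Definition slForm (x : gen) (u v : slSpace) : K := match x with
  | GX k => slCoef (GX 1) u * slCoef (GX k.-1) v * (3 <= k)%N%:R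
            + slCoef (GT 1) u * slCoef (GX k) v * k%:R
            + slCoef (GT 2) u * slCoef (GX k) v * (2 <= k)%N%:R
  | GT _ => 0
  | GY k => slCoef (GX 1) u * slCoef (GY k.-1) v * (2 <= k)%N%:R
            + slCoef (GT 1) u * slCoef (GY k) v * k%:R
            + slCoef (GT 3) u * slCoef (GY k) v * 1
  end.

Lemma ifR (b x : bool) : (if b then x%:R else 0 : K) = (b && x)%:R.
Proof. by case: b. Qed.

Lemma coord_bracket0 c u v :
  slCoord c (bilinearExt slBracket0 u v) = slForm (slName c) u v.
Proof.
rewrite coord_sum.
under eq_bigr => a _.
  rewrite coord_sum; under eq_bigr => b _ do rewrite coordZ; over.
have hc : match slName c with GX k => (0 < k <= n)%N | GY k => (0 < k <= m)%N
   | GT _ => true end by case: c => [[c|c]|c] /=; rewrite ?ltn_ord.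
move: (coord_vec c); move: (slName c) hc => x hc cv.
rewrite /slForm; case: x hc cv => [k|l|k] hk cv.
- rewrite -!sum_coef2 -!big_split; apply: eq_bigr => a _.
  rewrite -!big_split; apply: eq_bigr => b _ /=; rewrite -!mulrDr.
  congr (_ * _); rewrite /slBracket0.
  case: (slName a) => [[|[|i]]|[|[|[|[|i]]]]|i]; case: (slName b) => [j|j|j];
    rewrite ?(fun_if (slCoord c)) ?coordZ ?coord0 ?cv ?eqE /=
      ?mulr0 ?mul0r ?mulr1 ?mul1r ?addr0 ?add0r ?if_same //.
  + by rewrite -natrM mulnb ifR; congr (nat_of_bool _)%:R; lia.
  + by rewrite eq_sym; case: eqP => [->|_]; rewrite ?mulr1 ?mulr0 ?mul1r ?mul0r.
  + by rewrite -natrM mulnb ifR; congr (nat_of_bool _)%:R; lia.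
- rewrite big1 // => a _; rewrite big1 // => b _; rewrite /slBracket0.
  case: (slName a) => [[|[|i]]|[|[|[|[|i]]]]|i]; case: (slName b) => [j|j|j];
  by rewrite ?(fun_if (slCoord c)) ?coordZ ?coord0 ?cv ?eqE /=
      ?mulr0 ?if_same ?mulr0.
- rewrite -!sum_coef2 -!big_split; apply: eq_bigr => a _.
  rewrite -!big_split; apply: eq_bigr => b _ /=; rewrite -!mulrDr.
  congr (_ * _); rewrite /slBracket0.
  case: (slName a) => [[|[|i]]|[|[|[|[|i]]]]|i]; case: (slName b) => [j|j|j];
    rewrite ?(fun_if (slCoord c)) ?coordZ ?coord0 ?cv ?eqE /=
      ?mulr0 ?mul0r ?mulr1 ?mul1r ?addr0 ?add0r ?if_same //.
  + by rewrite -natrM mulnb ifR; congr (nat_of_bool _)%:R; lia.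
  + by rewrite eq_sym; case: eqP => [->|_]; rewrite ?mulr1 ?mulr0 ?mul1r ?mul0r.
  + by rewrite eq_sym.
Qed.

Lemma coef_slBracket c u v :
  slCoef (slName c) (slBracket u v) =
  slForm (slName c) u v - slForm (slName c) v u.
Proof. by rewrite coef_name slBracketE coordB !coord_bracket0. Qed.

Lemma coef_slBracketT l u v : slCoef (GT l) (slBracket u v) = 0.
Proof.
have [[b hb]|h] := pselect (exists b, slName b = GT l).
  by rewrite -hb coef_slBracket hb subrr.
by apply: coef_out => b; apply/eqP => e; apply: h; exists b.
Qed.

Lemma coef_slBracketX1 u v : slCoef (GX 1) (slBracket u v) =
  slCoef (GT 1) u * slCoef (GX 1) v - slCoef (GT 1) v * slCoef (GX 1) u.
Proof.
have [[b hb]|h] := pselect (exists b, slName b = GX 1).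
  by rewrite -hb coef_slBracket hb /slForm /= !(mulr0, mulr1, addr0, add0r).
have h0 w : slCoef (GX 1) w = 0.
  by apply: coef_out => b; apply/eqP => e; apply: h; exists b.
by rewrite !h0 !mulr0 subrr.
Qed.

Lemma slJacobi u v w : slBracket u (slBracket v w) =
  slBracket (slBracket u v) w + slBracket v (slBracket u w).
Proof.
apply: coordP => c; rewrite coordD -!coef_name !coef_slBracket.
case: c => [[k|l]|k] /=; last 2 first.
- by rewrite !subrr addr0.
- rewrite !coef_slBracketT !coef_slBracketX1.
  have hk := coef_slBracket (inr k : slIndex); rewrite /= in hk; rewrite !hk.
  case: (ltnP 1 k.+1) => k2 /=; last by ring.
  have k' : (k.-1 < m)%N by have := ltn_ord k; lia.
  have := coef_slBracket (inr (Ordinal k') : slIndex).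
  rewrite /= prednK // => hk'; rewrite !hk'.
  ring.
- rewrite !coef_slBracketT !coef_slBracketX1.
  have hk := coef_slBracket (inl (inl k) : slIndex); rewrite /= in hk.
  rewrite !hk.
  case: (ltnP 2 k.+1) => k2 /=; last by ring.
  have k' : (k.-1 < n)%N by have := ltn_ord k; lia.
  have := coef_slBracket (inl (inl (Ordinal k')) : slIndex).
  rewrite /= prednK; last by lia.
  rewrite (_ : (1 < k.+1)%N = true); last by lia.
  rewrite (_ : (1 < k)%N = true); last by lia.
  move=> hk'; rewrite !hk'.
  ring.
Qed.

Lemma coef_evenY (u : slSpace) j : u.2 = 0 -> slCoef (GY j) u = 0.
Proof.
move=> h; rewrite /slCoef big1 // => -[[b|b]|b] _; rewrite ?mul0r //=.
by rewrite h ffunE mulr0.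
Qed.

Lemma coef_oddXT (u : slSpace) k : u.1 = 0 ->
  slCoef (GX k) u = 0 /\ slCoef (GT k) u = 0.
Proof.
move=> h; split; rewrite /slCoef big1 // => -[[b|b]|b] _; rewrite ?mul0r //=;
  by rewrite h ffunE mulr0.
Qed.

Lemma slBracket_hom a b (u v : slSpace) :
  hom a u -> hom b v -> hom (a (+) b) (slBracket u v).
Proof.
have coordE c x y : slCoord c (slBracket x y) =
    slForm (slName c) x y - slForm (slName c) y x.
  by rewrite -coef_name coef_slBracket.
case: a b => -[] /= hu hv; apply/ffunP => c.
- have := coordE (inr c) u v => /= ->.
  by rewrite ffunE !(coef_oddXT _ hu).1 !(coef_oddXT _ hu).2
    !(coef_oddXT _ hv).1 !(coef_oddXT _ hv).2 !mul0r !addr0 subrr.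
- have := coordE (inl c) u v => /= ->; case: c => c /=; rewrite ?ffunE ?subrr //.
  by rewrite !(coef_oddXT _ hu).1 !(coef_oddXT _ hu).2 !(mul0r,mulr0,addr0,subrr).
- have := coordE (inl c) u v => /= ->; case: c => c /=; rewrite ?ffunE ?subrr //.
  by rewrite !(coef_oddXT _ hv).1 !(coef_oddXT _ hv).2 !(mul0r,mulr0,addr0,subrr).
- have := coordE (inr c) u v => /= ->.
  by rewrite ffunE !(coef_evenY _ hu) !(coef_evenY _ hv) !(mul0r,mulr0,addr0,subrr).
Qed.

Lemma slBracket_odd (u v : slSpace) :
  hom true u -> hom true v -> slBracket u v = 0.
Proof.
move=> /= hu hv; apply: coordP => c; rewrite -!coef_name coef_slBracket.
rewrite coef_name coord0.
case: (slName c) => [k|l|k] /=; rewrite ?subrr //.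
  by rewrite !(coef_oddXT _ hu).1 !(coef_oddXT _ hu).2
    !(coef_oddXT _ hv).1 !(coef_oddXT _ hv).2 !mul0r !addr0 subrr.
by rewrite !(coef_oddXT _ hu).1 !(coef_oddXT _ hu).2
    !(coef_oddXT _ hv).1 !(coef_oddXT _ hv).2 !mul0r !addr0 subrr.
Qed.

Lemma slBracket0r u : slBracket u 0 = 0.
Proof.
have := bilinearExt_linearr (fun a b => slBracket0 a b - slBracket0 b a) 1 u 0 0.
by rewrite !scale1r addr0 => /esym/eqP; rewrite -subr_eq0 addrK => /eqP.
Qed.

Lemma slBracketxx u : slBracket u u = 0.
Proof. by rewrite slBracketE subrr. Qed.

Lemma slBracket_sskew a b (u v : slSpace) : hom a u -> hom b v ->
  slBracket u v = - ((-1) ^+ (a && b) *: slBracket v u).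
Proof.
case: a b => -[] hu hv; rewrite /= ?expr0 ?scale1r -?slBracket_skew //.
by rewrite !slBracket_odd // scaler0 oppr0.
Qed.

Lemma slBracket_sjacobi a b c (u v w : slSpace) :
  hom a u -> hom b v -> hom c w ->
  slBracket u (slBracket v w) =
  slBracket (slBracket u v) w + (-1) ^+ (a && b) *: slBracket v (slBracket u w).
Proof.
move=> hu hv hw; rewrite slJacobi; congr (_ + _).
case: a b hu hv => -[] hu hv; rewrite /= ?expr0 ?scale1r //.
suff -> : slBracket v (slBracket u w) = 0 by rewrite scaler0.
case: c hw => hw; first by rewrite (slBracket_odd hu hw) slBracket0r.
by rewrite slBracket_odd //; apply: (slBracket_hom (a := true) (b := false)).
Qed.

Lemma slBracket_cube (u : slSpace) :
  hom true u -> slBracket u (slBracket u u) = 0.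
Proof. by rewrite slBracketxx slBracket0r. Qed.

Definition SL : lieSuperalgebra K :=
  @LieSuperalgebra K slEven slOdd slBracket
    (bilinearExt_linearl _) (bilinearExt_linearr _) slBracket_hom
    slBracket_sskew slBracket_sjacobi (fun u _ => slBracketxx u) slBracket_cube.

Definition c1 (p : nat) : slSpace -> slSpace -> slSpace :=
  bilinearExt (fun a b => match a, b with
    | GX 1, GY j => if j == p then eY 1 else 0
    | GY j, GX 1 => if j == p then - eY 1 else 0
    | _, _ => 0
    end).

Definition c2 (p : nat) : slSpace -> slSpace -> slSpace :=
  bilinearExt (fun a b => match a, b with
    | GX 1, GX i => if i == p.+1 then eX 2 else 0
    | GX i, GX 1 => if i == p.+1 then - eX 2 else 0
    | _, _ => 0
    end).

Definition slDeg (x : gen) : int := match x with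
  | GX r => r%:Z
  | GY s => (n + s)%N%:Z
  | GT _ => 0
  end.

Definition homogeneous (d : int) (u : slSpace) : Prop :=
  forall b, slCoord b u != 0 -> slDeg (slName b) = d.

Definition hasDegree (d : int) (f : slSpace -> slSpace -> slSpace) : Prop :=
  forall a b u v, homogeneous a u -> homogeneous b v ->
    homogeneous (a + b + d) (f u v).

End SL.

Arguments c1 : clear implicits.
Arguments c2 : clear implicits.

(* Main.v *)
Require Import Defs.
From HB Require Import structures.
From mathcomp Require Import all_boot all_order all_algebra.
From mathcomp Require Import boolp functions.
From mathcomp Require Import zify ring.

Set Implicit Arguments.
Unset Strict Implicit.
Unset Printing Implicit Defensive.

Import GRing.Theory.
Local Open Scope ring_scope.

(** The torus spanned by T_1, T_2, T_3 acts diagonally, with all weights in the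
    prime field.  By Cartan's formula (lemma [cartan]) the Lie derivative of a
    2-cocycle f along T_l is the coboundary of the contraction of f by T_l.
    Dividing by the eigenvalue, which differs from zero for some l on each
    component of nonzero weight, makes all these components a coboundary
    ([weight_reduction]), so that only the components of weight zero matter.

    For p > 2 few components have weight zero: no value has the weight of
    X_i X_j, X_i Y_j (i, j > 1) or Y_i Y_j, and what is left are maps

      T_k, T_l -> T_r;  T_l, x -> x;  X_1, X_i -> X_(i+1);  X_1, Y_j -> Y_(j+1);
      X_1, X_(p+1) -> X_2;  X_1, Y_p -> Y_1,

    the last two because indices only count modulo p; they exist only for
    n = p + 1 and m = p respectively, and they are multiples of c_2 and c_1.
    The cocycle equations kill the first family ([f_TT]) and force each
    T_l, x -> x to be the action of an element of the torus ([mu_inner]); a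
    linear map [correction] that preserves the torus and is diagonal on the X_i
    and Y_j then has all the components other than these two as its coboundary
    ([cocycle_normal_form]).

    Both c_1 and c_2 have the form of a wedge of two coordinate forms times a
    fixed vector, which is a cocycle by a direct computation
    ([wedge_isCocycle]).  They are independent modulo coboundaries because
    neither Y_1 nor X_2 is a component of a bracket that can occur in the value
    of a coboundary at (X_1, Y_p), respectively (X_1, X_(p+1))
    ([coboundary_coefs]). *)

(** * Cochains of degree at most two *)

Section LowDegree.
Variables (K : fieldType) (g : lieSuperalgebra K) (A : superModule g).
Implicit Types (c : precochain A) (x y z : ev g) (h k l : od g).

Lemma signsE : ((-1) ^+ 0 = 1 :> K) * ((-1) ^+ 1 = -1 :> K) *
  ((-1) ^+ 2 = 1 :> K) * ((-1) ^+ 3 = -1 :> K) * ((-1) ^+ 4 = 1 :> K).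
Proof. by do !split; rewrite -signr_odd. Qed.

(* Unfolds the sums in the differential at argument lists of concrete length. *)
Ltac expand_differential :=
  rewrite /differential; do ?rewrite ?(big_ord_recl, big_ord0) /=;
  rewrite /del /bump /= ?signsE;
  rewrite ?(scale1r, scaleN1r, scaler0, addr0, add0r, subr0, addrA) /=.

Lemma differential_ee c x y : differential c [:: x; y] [::] =
  c [:: (sbr (einj x) (einj y)).1] [::] - act (einj x) (c [:: y] [::])
  + act (einj y) (c [:: x] [::]).
Proof. by expand_differential. Qed.

Lemma differential_eo c x h : differential c [:: x] [:: h] =
  c [::] [:: (sbr (einj x) (oinj h)).2] - act (einj x) (c [::] [:: h])
  + act (oinj h) (c [:: x] [::]).
Proof. by expand_differential. Qed.

Lemma differential_oo c h k : differential c [::] [:: h; k] =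
  c [:: (sbr (oinj h) (oinj k)).1] [::]
  - (act (oinj h) (c [::] [:: k]) + act (oinj k) (c [::] [:: h])).
Proof. by expand_differential. Qed.

Lemma differential_eee c x y z : differential c [:: x; y; z] [::] =
  c [:: (sbr (einj x) (einj y)).1; z] [::]
  - c [:: (sbr (einj x) (einj z)).1; y] [::]
  + c [:: (sbr (einj y) (einj z)).1; x] [::]
  - act (einj x) (c [:: y; z] [::]) + act (einj y) (c [:: x; z] [::])
  - act (einj z) (c [:: x; y] [::]).
Proof. by expand_differential. Qed.

Lemma differential_eeo c x y h : differential c [:: x; y] [:: h] =
  c [:: (sbr (einj x) (einj y)).1] [:: h]
  + c [:: y] [:: (sbr (einj x) (oinj h)).2]
  - c [:: x] [:: (sbr (einj y) (oinj h)).2]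
  - act (einj x) (c [:: y] [:: h]) + act (einj y) (c [:: x] [:: h])
  - act (oinj h) (c [:: x; y] [::]).
Proof. by expand_differential. Qed.

Lemma differential_eoo c x h k : differential c [:: x] [:: h; k] =
  c [::] [:: (sbr (einj x) (oinj h)).2; k]
  + c [::] [:: (sbr (einj x) (oinj k)).2; h]
  + c [:: (sbr (oinj h) (oinj k)).1; x] [::]
  - act (einj x) (c [::] [:: h; k])
  + act (oinj h) (c [:: x] [:: k]) + act (oinj k) (c [:: x] [:: h]).
Proof. by expand_differential. Qed.

Lemma differential_ooo c h k l : differential c [::] [:: h; k; l] =
  c [:: (sbr (oinj h) (oinj k)).1] [:: l]
  + c [:: (sbr (oinj h) (oinj l)).1] [:: k]
  + c [:: (sbr (oinj k) (oinj l)).1] [:: h]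
  - (act (oinj h) (c [::] [:: k; l]) + act (oinj k) (c [::] [:: h; l])
     + act (oinj l) (c [::] [:: h; k])).
Proof. by expand_differential. Qed.

Lemma size_del (T : Type) i (s : seq T) :
  (i < size s)%N -> size (del i s) = (size s).-1.
Proof. by move=> hi; rewrite size_cat size_take size_drop hi; lia. Qed.

Lemma act0r (u : carrier g) : act u (0 : mcarrier A) = 0.
Proof.
have := act_linearr 1 u (0 : mcarrier A) 0.
by rewrite !scale1r !addr0 => /esym/eqP; rewrite -subr_eq0 addrK => /eqP.
Qed.

Lemma differential_size q c gs hs : isCochain q c ->
  (size gs + size hs)%N != q.+1 -> differential c gs hs = 0.
Proof.
case=> c0 _ _ _ _ hq; rewrite /differential.
rewrite !big1 ?scaler0 ?addr0 //= => [s _|s _|t _|s _|t _].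
- rewrite c0 ?act0r //.
  by rewrite size_del //; have := ltn_ord s; lia.
- rewrite c0 ?act0r ?scaler0 //.
  by rewrite size_del //; have := ltn_ord s; lia.
- rewrite big1 // => s _; rewrite c0 //=.
  have st := ltn_ord s; have th := ltn_ord t.
  by rewrite !size_del ?size_del //; lia.
- rewrite big1 // => t _; rewrite c0 ?scaler0 //=.
  by rewrite !size_del //; have := ltn_ord s; have := ltn_ord t; lia.
- rewrite big1 // => s _; rewrite c0 ?scaler0 //=.
  have st := ltn_ord s; have th := ltn_ord t.
  by rewrite !size_del ?size_del //; lia.
Qed.

Lemma einjP a x y : einj (a *: x + y) = a *: einj x + einj y :> carrier g.
Proof. by congr (_, _); rewrite /= scaler0 addr0. Qed.

Lemma oinjP a h k : oinj (a *: h + k) = a *: oinj h + oinj k :> carrier g.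
Proof. by congr (_, _); rewrite /= scaler0 addr0. Qed.

Lemma hom_einj x : Defs.hom false (einj x). Proof. by []. Qed.

Lemma hom_oinj h : Defs.hom true (oinj h). Proof. by []. Qed.

Lemma einj_sbr_ee x y :
  einj (sbr (einj x) (einj y)).1 = sbr (einj x) (einj y).
Proof.
have := sbr_hom (hom_einj x) (hom_einj y).
by rewrite /hom /=; case: (sbr _ _) => s0 s1 /= ->.
Qed.

Lemma oinj_sbr_eo x h :
  oinj (sbr (einj x) (oinj h)).2 = sbr (einj x) (oinj h).
Proof.
have := sbr_hom (hom_einj x) (hom_oinj h).
by rewrite /hom /=; case: (sbr _ _) => s0 s1 /= ->.
Qed.

Lemma einj_sbr_oo h k :
  einj (sbr (oinj h) (oinj k)).1 = sbr (oinj h) (oinj k).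
Proof.
have := sbr_hom (hom_oinj h) (hom_oinj k).
by rewrite /hom /=; case: (sbr _ _) => s0 s1 /= ->.
Qed.

Lemma sbr_oo_sym h k :
  sbr (oinj h) (oinj k) = sbr (oinj k) (oinj h) :> carrier g.
Proof.
rewrite (sbr_skew (hom_oinj h) (hom_oinj k)) expr1 scaleN1r.
exact: opprK.
Qed.

(** The two components of a 1-cochain are the restrictions of one linear map
    to the even and the odd part. *)
Definition cochain1 (phi : carrier g -> mcarrier A) : precochain A :=
  fun gs hs => match gs, hs with
  | [:: x], [::] => phi (einj x)
  | [::], [:: h] => phi (oinj h)
  | _, _ => 0
  end.

Lemma isCochain_cochain1 phi : linear phi -> isCochain 1 (cochain1 phi).
Proof.
move=> lin; split.
- by case=> [|x [|y gs]] [|h [|k hs]].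
- move=> a x y [|u [|v gs1]] [|w gs2] [|h hs] //=;
    by rewrite ?scaler0 ?addr0 // einjP lin.
- move=> a h k [|u [|v gs]] [|h' [|k' hs1]] [|l hs2] //=;
    by rewrite ?scaler0 ?addr0 // oinjP lin.
- by move=> x [|u [|v gs1]] [|w gs2] [|w' gs3] [|h hs].
- move=> gs hs hs' e; have [s1|s1] := leqP (size hs') 1.
    by rewrite (perm_small_eq s1 e).
  move: s1 (perm_size e); case: hs' {e} => [|h' [|k' hs']] // _.
  by case: hs => [|h [|k hs]] //=; case: gs.
Qed.

Lemma cochain1P c : isCochain 1 c -> exists2 phi, linear phi & c = cochain1 phi.
Proof.
case=> c0 ce co _ _; exists (fun u => c [:: u.1] [::] + c [::] [:: u.2]).
  move=> a u v /=; rewrite (ce a _ _ [::] [::]) (co a _ _ _ [::] [::]).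
  by rewrite scalerDr addrACA.
have ce0 : c [:: 0] [::] = 0.
  have := ce 1 0 0 [::] [::] [::]; rewrite /= !scale1r !addr0.
  by move=> /esym/eqP; rewrite -subr_eq0 addrK => /eqP.
have co0 : c [::] [:: 0] = 0.
  have := co 1 0 0 [::] [::] [::]; rewrite /= !scale1r !addr0.
  by move=> /esym/eqP; rewrite -subr_eq0 addrK => /eqP.
apply/funext => -[|x [|y gs]]; apply/funext => -[|h [|k hs]] /=;
  by rewrite ?(ce0, co0, addr0, add0r) // c0 //= addnC.
Qed.

Lemma perm_eq_pair (T : eqType) (a b a' b' : T) :
  perm_eq [:: a; b] [:: a'; b'] -> (a = a' /\ b = b') \/ (a = b' /\ b = a').
Proof.
move=> e; have := perm_mem e a; rewrite !inE eqxx /= => /esym/orP[]/eqP ae.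
  left; move: e; rewrite ae perm_cons.
  by move=> /(@perm_small_eq _ [:: b] [:: b'] isT) [->].
right; move: e; rewrite ae -[[:: a'; b']]/([:: a'] ++ [:: b']) perm_sym.
by rewrite perm_catC perm_cons => /(@perm_small_eq _ [:: a'] [:: b] isT) [->].
Qed.

Definition bilinear_map (f : carrier g -> carrier g -> mcarrier A) : Prop :=
  (forall u, linear (f u)) /\ (forall v, linear (f^~ v)).

(** [cochain2] reads f on the pairs (even, even), (even, odd) and (odd, odd):
    the conditions on the first and on the last of them are the antisymmetry in
    the even arguments and the symmetry in the odd ones. *)
Record super_alternating (f : carrier g -> carrier g -> mcarrier A) : Prop :=
  SuperAlternating {
    sa_bilinear : bilinear_map f;
    sa_even : forall x, f (einj x) (einj x) = 0;
    sa_odd : forall h k, f (oinj h) (oinj k) = f (oinj k) (oinj h)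
  }.

Lemma isCochain_cochain2 f : super_alternating f -> isCochain 2 (cochain2 A f).
Proof.
case=> -[linr linl] fe fo; split.
- by case=> [|x [|y [|z gs]]] [|h [|k [|l hs]]].
- move=> a x y [|u [|v [|v' gs1]]] [|w [|w' gs2]] [|h [|k hs]] //=;
    by rewrite ?scaler0 ?addr0 // einjP ?linr ?linl.
- move=> a h k [|u [|v [|v' gs]]] [|h1 [|h2 [|h3 hs1]]] [|l1 [|l2 hs2]] //=;
    by rewrite ?scaler0 ?addr0 // oinjP ?linr ?linl.
- by move=> x [|u [|v [|v' gs1]]] [|w [|w' gs2]] [|w'' gs3] [|h hs] /=.
- move=> gs hs hs' e; have [s1|s1] := leqP (size hs') 1.
    by rewrite (perm_small_eq s1 e).
  move: s1 e (perm_size e); case: hs' => [|h' [|k' hs']] // _.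
  case: hs => [|h [|k hs]] //=.
  case: hs hs' => [|l hs] [|l' hs'] //= e _; case: gs => [|x [|y [|z gs]]] //.
  by case: (perm_eq_pair e) => -[-> ->] //=; rewrite fo.
Qed.

(** The bilinear map is the sum of the three components of c, each applied to
    the even and odd parts of its arguments; its values at pairs (odd, even)
    vanish. *)
Lemma cochain2P c : isCochain 2 c ->
  exists2 f, super_alternating f & c = cochain2 A f.
Proof.
case=> c0 ce co ca cs.
have ce0 x : c [:: x; 0] [::] = 0 /\ c [:: 0; x] [::] = 0.
  have := ce 1 0 0 [:: x] [::] [::]; have := ce 1 0 0 [::] [:: x] [::].
  rewrite /= !scale1r !addr0 => /esym/eqP; rewrite -subr_eq0 addrK => /eqP ->.
  by move=> /esym/eqP; rewrite -subr_eq0 addrK => /eqP ->.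
have ce1 h : c [:: 0] [:: h] = 0.
  have := ce 1 0 0 [::] [::] [:: h]; rewrite /= !scale1r !addr0.
  by move=> /esym/eqP; rewrite -subr_eq0 addrK => /eqP.
have co0 x : c [:: x] [:: 0] = 0.
  have := co 1 0 0 [:: x] [::] [::]; rewrite /= !scale1r !addr0.
  by move=> /esym/eqP; rewrite -subr_eq0 addrK => /eqP.
have co1 h : c [::] [:: h; 0] = 0 /\ c [::] [:: 0; h] = 0.
  have := co 1 0 0 [::] [:: h] [::]; have := co 1 0 0 [::] [::] [:: h].
  rewrite /= !scale1r !addr0 => /esym/eqP; rewrite -subr_eq0 addrK => /eqP ->.
  by move=> /esym/eqP; rewrite -subr_eq0 addrK => /eqP ->.
have add3 (x1 y1 x2 y2 x3 y3 : mcarrier A) :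
    (x1 + y1) + (x2 + y2) + (x3 + y3) = (x1 + x2 + x3) + (y1 + y2 + y3).
  by rewrite [X in X + (x3 + y3)]addrACA [LHS]addrACA.
pose f (u v : carrier g) :=
  c [:: u.1; v.1] [::] + c [:: u.1] [:: v.2] + c [::] [:: u.2; v.2].
exists f.
  split; [split=> u a v w|move=> x|move=> h k]; rewrite /f /=.
  - rewrite (ce a _ _ [:: _] [::]) (co a _ _ [:: _] [::] [::]).
    by rewrite (co a _ _ [::] [:: _] [::]) !scalerDr add3.
  - rewrite (ce a _ _ [::] [:: _]) (ce a _ _ [::] [::]).
    by rewrite (co a _ _ [::] [::] [:: _]) !scalerDr add3.
  - by rewrite (ca x [::] [::] [::]) co0 (co1 _).1 !addr0.
  - rewrite (ce0 _).1 !ce1 !add0r; apply: cs.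
    by rewrite -[[:: h; k]]/([:: h] ++ [:: k]) perm_catC.
apply/funext => -[|x [|y [|z gs]]]; apply/funext => -[|h [|k [|l hs]]];
  rewrite /f /= ?(co0, ce1, (ce0 _).1, (co1 _).1, (co1 _).2, addr0, add0r) //;
  by rewrite c0 //= addnC.
Qed.

(** The parity change (u.1, - u.2) produces the sign of the last term in a
    bilinear way: on the pairs that [cochain2] reads, this sign is -1 exactly
    when u is odd. *)
Definition d1 (phi : carrier g -> mcarrier A) (u v : carrier g) : mcarrier A :=
  phi (sbr u v) - act u (phi v) + act v (phi (u.1, - u.2)).

Lemma linear_zero (V W : lmodType K) (phi : V -> W) : linear phi -> phi 0 = 0.
Proof.
move=> lin; have := lin 1 0 0; rewrite /= !scale1r !addr0.
by move=> /esym/eqP; rewrite -subr_eq0 addrK => /eqP.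
Qed.

Lemma linear_opp (V W : lmodType K) (phi : V -> W) u :
  linear phi -> phi (- u) = - phi u.
Proof.
move=> lin; have := lin (-1) u 0.
by rewrite /= !scaleN1r !addr0 (linear_zero lin) addr0.
Qed.

Lemma actN (u : carrier g) (v : mcarrier A) : act u (- v) = - act u v.
Proof. exact/linear_opp/(fun a => act_linearr a u). Qed.

Lemma par_oinj h : (0, - h) = - oinj h :> carrier g.
Proof. by congr (_, _); rewrite /= oppr0. Qed.

Lemma super_alternating_d1 phi : linear phi -> super_alternating (d1 phi).
Proof.
move=> lin.
have add3 (x1 y1 x2 y2 x3 y3 : mcarrier A) :
    (x1 + y1) - (x2 + y2) + (x3 + y3) = (x1 - x2 + x3) + (y1 - y2 + y3).
  by rewrite opprD [X in X + (x3 + y3)]addrACA [LHS]addrACA.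
split; [split=> u a v w|move=> x|move=> h k]; rewrite /d1.
- rewrite sbr_linearr (lin a (sbr u v) (sbr u w)) (lin a v w) act_linearl.
  by rewrite act_linearr add3 !scalerDr scalerN.
- have -> : ((a *: v + w).1, - (a *: v + w).2) =
      a *: (v.1, - v.2) + (w.1, - w.2) :> carrier g.
    by congr (_, _); rewrite /= scalerN opprD.
  rewrite sbr_linearl (lin a (sbr v u) (sbr w u)) (lin a (_, _) (_, _)).
  rewrite act_linearl.
  by rewrite act_linearr add3 !scalerDr scalerN.
- by rewrite (sbr_even (hom_einj x)) (linear_zero lin) /= oppr0 add0r addNr.
- rewrite sbr_oo_sym /=.
  by rewrite !par_oinj !(linear_opp _ lin) !actN addrAC.
Qed.

Lemma differential_cochain1 phi : linear phi ->
  differential (cochain1 phi) = cochain2 A (d1 phi).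
Proof.
move=> lin; apply/funext => gs; apply/funext => hs.
have [e|ne] := eqVneq (size gs + size hs)%N 2%N; last first.
  rewrite (differential_size (isCochain_cochain1 lin)) //.
  by have [->] := isCochain_cochain2 (super_alternating_d1 lin).
case: gs hs e => [|x [|y [|z gs]]] [|h [|k [|l hs]]] // _; rewrite /= /d1 /=.
- rewrite differential_oo /= einj_sbr_oo opprD addrA; congr (_ + _).
  by rewrite par_oinj (linear_opp _ lin) actN.
- by rewrite differential_eo /= oinj_sbr_eo oppr0.
- by rewrite differential_ee /= einj_sbr_ee oppr0.
Qed.

Lemma even_skew f x y : super_alternating f ->
  f (einj x) (einj y) = - f (einj y) (einj x).
Proof.
case=> -[linr linl] fe _; apply/eqP; rewrite -addr_eq0.
have := fe (1 *: x + y); rewrite einjP linr linl linl !fe.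
by rewrite !scaler0 !scale1r add0r addr0 => /eqP; rewrite addrC.
Qed.

(** Cartan's formula for a cocycle: the Lie derivative of f along an even
    element x is the coboundary of the contraction of f by x, since the
    contraction of the differential of f vanishes.  The condition [a ==> b]
    excludes the pairs (odd, even). *)
Lemma cartan f x (u v : carrier g) a b : super_alternating f ->
  differential (cochain2 A f) = 0 ->
  Defs.hom a u -> Defs.hom b v -> a ==> b ->
  f (sbr (einj x) u) v + f u (sbr (einj x) v) - act (einj x) (f u v)
  = d1 (f (einj x)) u v.
Proof.
move=> fA df; have [[linr linl] fe fo] := fA.
have abel (p q r s t w : mcarrier A) :
    p + q - r - s + t - w = 0 -> p + q - s = r - t + w.
  move=> /eqP; rewrite subr_eq0 => /eqP <-.
  rewrite (addrAC (p + q)); set P := p + q - s.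
  by rewrite -(addrA P) [- r + t]addrC -(opprB t r) [RHS]addrC addrK.
have dfE gs hs : differential (cochain2 A f) gs hs = 0 by rewrite df.
case: u v => [u0 u1] [v0 v1]; rewrite /d1 /=.
case: a b => -[] //= -> -> _; apply: abel; rewrite -/(einj u0).
- have := dfE [:: x] [:: u1; v1]; rewrite differential_eoo /=.
  rewrite par_oinj.
  rewrite (fo _ u1) (even_skew _ x fA) !oinj_sbr_eo einj_sbr_oo.
  by rewrite (linear_opp _ (linr _)) actN opprK.
- have := dfE [:: x; u0] [:: v1]; rewrite differential_eeo /=.
  by rewrite !oinj_sbr_eo einj_sbr_ee oppr0.
- have := dfE [:: x; u0; v0] [::]; rewrite differential_eee /=.
  rewrite (even_skew _ u0 fA) (even_skew _ x fA) opprK oppr0.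
  by rewrite !einj_sbr_ee.
Qed.
End LowDegree.

(** * Dimension of a cohomology space *)

Lemma hasDim_basis (K : fieldType) (V : lmodType K) d (e : 'I_d -> V) :
  (forall v, exists a : 'rV[K]_d, v = \sum_i a 0 i *: e i) ->
  (forall a : 'rV[K]_d, \sum_i a 0 i *: e i = 0 -> a = 0) -> hasDim V d.
Proof.
move=> span indep; pose comb (a : 'rV[K]_d) := \sum_i a 0 i *: e i.
have comb_lin : linear comb.
  move=> r a b; rewrite /comb scaler_sumr -big_split; apply: eq_bigr => i _.
  by rewrite !mxE scalerDl scalerA.
have comb_inj a b : comb a = comb b -> a = b.
  move=> /eqP; rewrite -subr_eq0 -scaleN1r addrC -comb_lin => /eqP /indep /eqP.
  by rewrite scaleN1r addrC subr_eq0 => /eqP.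
have [coords coordsK] := choice span.
constructor; exists coords.
  by move=> r u v; apply: comb_inj; rewrite comb_lin /comb -!coordsK.
exists comb => [v|a]; first by rewrite /comb -coordsK.
by apply: comb_inj; rewrite {1}/comb -coordsK.
Qed.

Section Classes.
Variables (K : fieldType) (g : lieSuperalgebra K) (A : superModule g) (q : nat).
Implicit Types z : cocycle A q.

Lemma cohomClass0 : cohomClass (0 : cocycle A q) = 0.
Proof.
rewrite -(scale0r (0 : cocycle A q)) cohomClassZ.
exact: (scale0r (cohomClass (0 : cocycle A q))).
Qed.

Lemma cohomClass_eq0 z : cohomClass z = 0 <-> isCoboundary q (val z).
Proof.
rewrite -cohomClass0; split=> [/eqP|h].
  by rewrite cohomClassE subr0 => /asboolP.
by apply/eqP; rewrite cohomClassE subr0; apply/asboolP.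
Qed.

Lemma cohom_ind (P : cohomology A q -> Prop) :
  (forall z, P (cohomClass z)) -> forall h, P h.
Proof. by move=> hP h; rewrite -[h]cohomClassK. Qed.

Lemma cohomology_span1 z1 :
  (forall z, exists a, isCoboundary q (val z - a *: val z1)) ->
  (forall a, isCoboundary q (a *: val z1) -> a = 0) ->
  hasDim (cohomology A q) 1 /\
  forall h : cohomology A q, exists a, h = a *: cohomClass z1.
Proof.
move=> span indep.
have spanH (h : cohomology A q) : exists a, h = a *: cohomClass z1.
  elim/cohom_ind: h => z; have [a za] := span z; exists a.
  have : cohomClass (z - a *: z1) = 0 by apply/cohomClass_eq0.
  rewrite -[- _]scaleN1r addrC cohomClassP cohomClassZ scaleN1r => /eqP.
  by rewrite addrC subr_eq0 => /eqP.
split=> //; apply: (@hasDim_basis _ _ _ (fun=> cohomClass z1)).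
  move=> h; have [a ->] := spanH h; exists (const_mx a).
  by rewrite big_ord_recl big_ord0 addr0 mxE.
move=> a; rewrite big_ord_recl big_ord0 addr0 => h.
apply/rowP => i; rewrite mxE ord1; apply: indep.
by move: h; rewrite -[_ *: _]cohomClassZ => /cohomClass_eq0.
Qed.

Lemma cohomology_span2 z1 z2 :
  (forall z, exists a b,
     isCoboundary q (val z - (a *: val z1 + b *: val z2))) ->
  (forall a b, isCoboundary q (a *: val z1 + b *: val z2) -> a = 0 /\ b = 0) ->
  hasDim (cohomology A q) 2 /\ forall h : cohomology A q, exists a b,
    h = a *: cohomClass z1 + b *: cohomClass z2.
Proof.
move=> span indep.
have combE a b : cohomClass (a *: z1 + b *: z2) =
    a *: cohomClass z1 + b *: cohomClass z2.
  by rewrite cohomClassP cohomClassZ.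
have spanH (h : cohomology A q) : exists a b,
    h = a *: cohomClass z1 + b *: cohomClass z2.
  elim/cohom_ind: h => z; have [a [b zab]] := span z; exists a, b.
  have : cohomClass (z - (a *: z1 + b *: z2)) = 0 by apply/cohomClass_eq0.
  rewrite -[- _]scaleN1r addrC cohomClassP combE scaleN1r => /eqP.
  by rewrite addrC subr_eq0 => /eqP.
split=> //.
apply: (@hasDim_basis _ _ _
  (fun i : 'I_2 => if i == 0 then cohomClass z1 else cohomClass z2)).
  move=> h; have [a [b ->]] := spanH h.
  exists (\row_i if i == 0 then a else b).
  by rewrite !big_ord_recl big_ord0 addr0 !mxE.
move=> a; rewrite !big_ord_recl big_ord0 addr0 /= -combE.
move=> /cohomClass_eq0 /indep [a0 a1].
apply/rowP => i; rewrite mxE; case: (unliftP ord0 i) => [j|] -> //.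
by rewrite ord1.
Qed.
End Classes.

(** * Coordinates and weights in SL *)

Definition gen_odd (x : gen) : bool := if x is GY _ then true else false.

Section Weights.
Variables (K : fieldType) (n m : nat).
Local Notation V := (slSpace K n m).
Local Notation e := (slVec K n m).
Local Notation br := (@slBracket K n m).
Local Notation g := (SL K n m).
Local Notation ad := (adjoint g).
Implicit Types (u v w : V) (x y z : gen).

(** The names of actual basis elements; for the other names [slVec] and
    [slCoef] are zero. *)
Definition valid x := match x with
  | GX k => 0 < k <= n | GT l => 0 < l <= 3 | GY k => 0 < k <= m end%N.

Lemma valid_name (b : slIndex n m) : valid (slName b).
Proof. by case: b => [[b|b]|b] /=; rewrite ltn_ord. Qed.

Lemma validP x : valid x -> exists b : slIndex n m, slName b = x.
Proof.
case: x => [[|k]|[|k]|[|k]] //= hk.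
- by exists (inl (inl (Ordinal hk))).
- by exists (inl (inr (Ordinal (hk : k < 3)%N))).
- by exists (inr (Ordinal hk)).
Qed.

Lemma coef_invalid x u : ~~ valid x -> slCoef x u = 0.
Proof.
move=> hx; apply: coef_out => b; apply: contra hx => /eqP <-.
exact: valid_name.
Qed.

Lemma coefP u v : (forall x, valid x -> slCoef x u = slCoef x v) -> u = v.
Proof.
by move=> h; apply: coordP => b; rewrite -!coef_name h // valid_name.
Qed.

Lemma coef_linear x : linear (@slCoef K n m x : V -> K^o).
Proof.
move=> a u v; rewrite /slCoef scaler_sumr -big_split; apply: eq_bigr => b _ /=.
by rewrite coordL mulrDr mulrCA.
Qed.

HB.instance Definition _ x := GRing.isLinear.Build K V K^o *:%R
  (@slCoef K n m x) (coef_linear x).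

Lemma slCoefZ x a u : slCoef x (a *: u) = a * slCoef x u.
Proof. exact: linearZ. Qed.

Lemma slCoefD x u v : slCoef x (u + v) = slCoef x u + slCoef x v.
Proof. exact: linearD. Qed.

Lemma slCoefB x u v : slCoef x (u - v) = slCoef x u - slCoef x v.
Proof. exact: linearB. Qed.

Lemma slCoefN x u : slCoef x (- u) = - slCoef x u.
Proof. exact: linearN. Qed.

Lemma slCoef0 x : slCoef x (0 : V) = 0.
Proof. exact: linear0. Qed.

Lemma coef_vec x y : slCoef x (e y) = ((x == y) && valid x)%:R.
Proof.
have [/validP[b <-]|hx] := boolP (valid x); last first.
  by rewrite coef_invalid // andbF.
by rewrite coef_name coord_vec andbT.
Qed.

Lemma vec_invalid x : ~~ valid x -> e x = 0.
Proof.
move=> hx; apply: coefP => y hy; rewrite coef_vec linear0 hy andbT.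
by case: eqP => // yx; rewrite yx (negbTE hx) in hy.
Qed.

Lemma basis_expansion u : u = \sum_b slCoord b u *: e (slName b).
Proof.
apply: coordP => c; rewrite coord_sum (bigD1 c) //= coordZ coord_vec eqxx.
rewrite mulr1 big1 ?addr0 // => b hb.
by rewrite coordZ coord_vec eq_sym (inj_eq (@name_inj n m)) (negbTE hb) mulr0.
Qed.

Lemma linear_expansion (phi : V -> V) u : linear phi ->
  phi u = \sum_b slCoord b u *: phi (e (slName b)).
Proof.
move=> lin; pose phiL := GRing.isLinear.Build K V V *:%R phi lin.
pose phi' : {linear V -> V} := HB.pack phi phiL.
rewrite {1}[u]basis_expansion -[phi]/(phi' : V -> V) linear_sum.
by apply: eq_bigr => b _; rewrite linearZ.
Qed.

Lemma br_linearr u : linear (br u).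
Proof. by move=> a v w; exact: bilinearExt_linearr. Qed.

Lemma coef_bracket x u v : valid x ->
  slCoef x (br u v) = slForm x u v - slForm x v u.
Proof. by move=> /validP[b <-]; rewrite coef_slBracket. Qed.

HB.instance Definition _ u := GRing.isLinear.Build K V V *:%R (br u)
  (br_linearr u).

Lemma brZr a u v : br u (a *: v) = a *: br u v.
Proof. exact: linearZ. Qed.

Lemma brZl a u v : br (a *: u) v = a *: br u v.
Proof. by rewrite slBracket_skew linearZ -scalerN -slBracket_skew. Qed.

(** The weight of a basis element: the eigenvalues of T_1, T_2, T_3 on it. *)
Definition wt x : {ffun 'I_3 -> K} := match x with
  | GX k => [ffun l : 'I_3 => [:: k%:R; (1 < k)%N%:R; 0]`_l]
  | GT _ => 0
  | GY k => [ffun l : 'I_3 => [:: k%:R; 0; 1]`_l]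
  end.

Definition eT (l : 'I_3) : V := e (GT l.+1).

Lemma coef_brT l x v : slCoef x (br (eT l) v) = wt x l * slCoef x v.
Proof.
have [hx|hx] := boolP (valid x); last by rewrite !coef_invalid ?mulr0.
rewrite coef_bracket // /eT.
case: l => -[|[|[|//]]] hl; case: x hx => k hk /=;
  rewrite ?coef_vec ?eqE /= ?ffunE /=
    ?(mul0r, mulr0, mul1r, mulr1, addr0, add0r, subr0, oppr0) //;
  by rewrite mulrC.
Qed.

Lemma brT l x : br (eT l) (e x) = wt x l *: e x.
Proof.
apply: coefP => z hz; rewrite coef_brT slCoefZ coef_vec hz andbT.
by case: eqP => [->|_] //; rewrite !mulr0.
Qed.

(** Derivations have weights that add: apply T_l to the bracket of x and y and
    use the Jacobi identity. *)
Lemma bracket_weight x y z :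
  slCoef z (br (e x) (e y)) != 0 -> wt z = wt x + wt y.
Proof.
move=> hz; apply/ffunP => l; apply: (mulIf hz).
rewrite -coef_brT slJacobi !brT brZl linearZ /= linearD /= !slCoefZ.
by rewrite ffunE mulrDl.
Qed.

Definition linext (G : slIndex n m -> V) u : V := \sum_b slCoord b u *: G b.

Lemma linext_linear G : linear (linext G).
Proof.
move=> a u v; rewrite /linext scaler_sumr -big_split; apply: eq_bigr => b _ /=.
by rewrite coordL scalerDl scalerA.
Qed.

Lemma linext_vec (G : gen -> V) x : (forall y, ~~ valid y -> G y = 0) ->
  linext (fun b => G (slName b)) (e x) = G x.
Proof.
move=> hG; rewrite /linext; have [/validP[b <-]|hx] := boolP (valid x).
  rewrite (bigD1 b) //= coord_vec eqxx scale1r big1 ?addr0 // => c hc.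
  by rewrite coord_vec (inj_eq (@name_inj n m)) (negbTE hc) scale0r.
rewrite (hG x hx) big1 // => b _.
by rewrite vec_invalid // Defs.coord0 scale0r.
Qed.

Definition of_coef (h : gen -> K) : V :=
  ([ffun b => h (slName (inl b : slIndex n m))],
   [ffun b => h (slName (inr b : slIndex n m))]).

Lemma coef_of_coef h x : slCoef x (of_coef h) = (valid x)%:R * h x.
Proof.
have [/validP[b <-]|hx] := boolP (valid x); last first.
  by rewrite coef_invalid // mul0r.
by rewrite coef_name mul1r; case: b => b; rewrite /= ffunE.
Qed.

(** Multiplies the component of phi from weight a to weight c by k (a - c). *)
Definition twist (k : {ffun 'I_3 -> K} -> K) (phi : V -> V) : V -> V :=
  linext (fun b => of_coef (fun z =>
    k (wt (slName b) - wt z) * slCoef z (phi (e (slName b))))).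

Lemma twist_linear k phi : linear (twist k phi).
Proof. exact: linext_linear. Qed.

Lemma coef_twist k phi : linear phi -> forall x z,
  slCoef z (twist k phi (e x)) = k (wt x - wt z) * slCoef z (phi (e x)).
Proof.
move=> lin x z; rewrite /twist.
rewrite (linext_vec (G := fun x =>
  of_coef (fun z => k (wt x - wt z) * slCoef z (phi (e x))))).
  rewrite coef_of_coef; have [hz|hz] := boolP (valid z); rewrite ?mul1r //.
  by rewrite (coef_invalid _ hz) mulr0 mul0r.
move=> y hy; apply: coefP => w hw; rewrite coef_of_coef (vec_invalid hy).
by rewrite (linear_zero lin) !linear0 !mulr0.
Qed.

Definition par u : V := (u.1, - u.2).

(** The expression [d1] for the adjoint module, written with the operations of
    the space underlying SL instead of those of the module. *)
Definition ad_d1 (phi : V -> V) u v : V :=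
  phi (br u v) - br u (phi v) + br v (phi (par u)).

Lemma par_vec x : par (e x) = (-1) ^+ gen_odd x *: e x.
Proof.
case: x => k /=; rewrite ?expr0 ?expr1 ?scale1r ?scaleN1r; congr (_, _);
  apply/ffunP => b; rewrite !ffunE ?eqE /= ?oppr0 //.
by case: b => b; rewrite /= oppr0.
Qed.

Lemma ad_d1_vec (phi : V -> V) x y : linear phi -> ad_d1 phi (e x) (e y) =
  phi (br (e x) (e y)) - br (e x) (phi (e y))
  + (-1) ^+ gen_odd x *: br (e y) (phi (e x)).
Proof.
move=> lin; rewrite /ad_d1 par_vec.
congr (_ + _); rewrite -linearZ; congr br.
by have := lin ((-1) ^+ gen_odd x) (e x) 0; rewrite (linear_zero lin) !addr0.
Qed.

Lemma coef_ad_d1_vec (phi : V -> V) x y z : linear phi ->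
  slCoef z (ad_d1 phi (e x) (e y)) =
  slCoef z (phi (br (e x) (e y))) - slCoef z (br (e x) (phi (e y)))
  + (-1) ^+ gen_odd x * slCoef z (br (e y) (phi (e x))).
Proof. by move=> lin; rewrite ad_d1_vec // slCoefD slCoefB slCoefZ. Qed.

(** The coboundary operator is equivariant for the torus, so rescaling phi by a
    function of the weight rescales its coboundary in the same way. *)
Lemma d1_rescale k (phi psi : V -> V) : linear phi -> linear psi ->
  (forall x z, slCoef z (psi (e x)) = k (wt x - wt z) * slCoef z (phi (e x))) ->
  forall x y z, slCoef z (ad_d1 psi (e x) (e y)) =
    k (wt x + wt y - wt z) * slCoef z (ad_d1 phi (e x) (e y)).
Proof.
move=> lin lin' psiE x y z.
rewrite (coef_ad_d1_vec _ _ _ lin') (coef_ad_d1_vec _ _ _ lin).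
have adE x' y' : slCoef z (br (e x') (psi (e y'))) =
    k (wt x' + wt y' - wt z) * slCoef z (br (e x') (phi (e y'))).
  rewrite [X in _ = _ * slCoef z X](linear_expansion _ (br_linearr _)).
  rewrite [X in slCoef z X = _](linear_expansion _ (br_linearr _)).
  rewrite !linear_sum mulr_sumr; apply: eq_bigr => b _; rewrite /= !slCoefZ.
  have [->|hb] := eqVneq (slCoef z (br (e x') (e (slName b)))) 0.
    by rewrite !mulr0.
  rewrite -!coef_name psiE (bracket_weight hb) mulrA.
  by rewrite (addrC (wt x')) addrKA.
rewrite (adE x y) (adE y x) mulrDr mulrBr mulrCA [wt y + wt x]addrC.
congr (_ - _ + _).
rewrite (linear_expansion _ lin') (linear_expansion _ lin).
rewrite !linear_sum mulr_sumr; apply: eq_bigr => b _.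
rewrite /= !slCoefZ -!coef_name.
have [->|hb] := eqVneq (slCoef (slName b) (br (e x) (e y))) 0.
  by rewrite !mul0r mulr0.
by rewrite psiE (bracket_weight hb) mulrCA.
Qed.

(** The inverse of one nonzero entry of th, at its index, and zero at the other
    indices: a choice of coefficients that combine the entries of th to 1
    whenever this is possible. *)
Definition sel (th : {ffun 'I_3 -> K}) (l : 'I_3) : K :=
  if [pick i | th i != 0] == Some l then (th l)^-1 else 0.

Lemma sum_sel th : \sum_l sel th l * th l = (th != 0)%:R.
Proof.
rewrite /sel; case: pickP => [i hi|h].
  rewrite (bigD1 i) //= eqxx mulVf // big1 ?addr0 => [|l hl].
    by case: eqP => // h; rewrite h ffunE eqxx in hi.
  by case: eqP => [[li]|]; [rewrite li eqxx in hl|rewrite mul0r].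
rewrite big1 => [|l _]; last by rewrite mul0r.
suff -> : th = 0 by rewrite eqxx.
by apply/ffunP => l; rewrite ffunE; apply/eqP; have /negbFE := h l.
Qed.

Lemma ad_d1_sum (phi : 'I_3 -> V -> V) u v :
  ad_d1 (fun w => \sum_l phi l w) u v = \sum_l ad_d1 (phi l) u v.
Proof.
rewrite /ad_d1 (linear_sum (br u)) (linear_sum (br v)) /=.
by rewrite -sumrB -big_split.
Qed.

Lemma ad_d1D (phi psi : V -> V) u v :
  ad_d1 (phi \+ psi) u v = ad_d1 phi u v + ad_d1 psi u v.
Proof.
have regroup (M : zmodType) (a a' b b' c c' : M) :
    (a + a') - (b + b') + (c + c') = (a - b + c) + (a' - b' + c').
  by rewrite opprD [X in X + (c + c')]addrACA [LHS]addrACA.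
by rewrite /ad_d1 /= (linearD (br u)) (linearD (br v)); exact: regroup.
Qed.

Lemma vec_hom x : Defs.hom (gen_odd x) (e x).
Proof.
by case: x => k; apply/ffunP => b; rewrite !ffunE ?eqE //; case: b => b.
Qed.

(** On the component (x, y; z) the Lie derivative along T_l is the
    multiplication by the l-th entry of wt x + wt y - wt z. *)
Lemma cartan_weight (f : V -> V -> V) l x y : super_alternating (A := ad) f ->
  differential (cochain2 ad f) = 0 -> gen_odd x ==> gen_odd y ->
  forall z, slCoef z (ad_d1 (f (eT l)) (e x) (e y)) =
  (wt x + wt y - wt z) l * slCoef z (f (e x) (e y)).
Proof.
move=> fA df hxy z; have [[linr linl] fe fo] := fA.
have eTE : eT l = einj (g := g) (eT l).1.
  by congr (_, _); apply/ffunP => b; rewrite !ffunE.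
have := @cartan K g ad f ((eT l).1 : ev g) (e x) (e y) _ _ fA df (vec_hom x)
  (vec_hom y) hxy; rewrite -eTE => cart.
have {cart}<- : f (br (eT l) (e x)) (e y) + f (e x) (br (eT l) (e y))
  - br (eT l) (f (e x) (e y)) = ad_d1 (f (eT l)) (e x) (e y) := cart.
rewrite !brT.
have -> : f (wt x l *: e x) (e y) = wt x l *: f (e x) (e y).
  have := linl (e y) (wt x l) (e x) 0; rewrite /= !addr0 => ->.
  by rewrite (linear_zero (linl _)) addr0.
have -> : f (e x) (wt y l *: e y) = wt y l *: f (e x) (e y).
  have := linr (e x) (wt y l) (e y) 0; rewrite /= !addr0 => ->.
  by rewrite (linear_zero (linr _)) addr0.
by rewrite slCoefB slCoefD !slCoefZ coef_brT !ffunE mulrDl mulrDl mulNr.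
Qed.

(** Each component of nonzero weight is divided by an eigenvalue: the primitive
    is the sum over l of the contractions by T_l, the component of weight th
    being multiplied by [sel th l]. *)
Lemma weight_reduction (f : V -> V -> V) : super_alternating (A := ad) f ->
  differential (cochain2 ad f) = 0 ->
  exists2 phi : V -> V, linear phi & forall x y z, gen_odd x ==> gen_odd y ->
    slCoef z (ad_d1 phi (e x) (e y)) =
    (wt x + wt y != wt z)%:R * slCoef z (f (e x) (e y)).
Proof.
move=> fA df; have [[linr linl] fe fo] := fA.
exists (fun u => \sum_l twist (fun th => sel th l) (f (eT l)) u).
  move=> a u v; rewrite scaler_sumr -big_split; apply: eq_bigr => l _ /=.
  exact: twist_linear.
move=> x y z hxy; rewrite ad_d1_sum linear_sum -subr_eq0 -sum_sel mulr_suml /=.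
apply: eq_bigr => l _; have linl' := linr (eT l).
rewrite (d1_rescale linl' (twist_linear _ _) (coef_twist _ linl')).
by rewrite (cartan_weight _ fA df hxy) mulrA.
Qed.
End Weights.

(** * Brackets of basis elements *)

Section BasisBrackets.
Variables (K : fieldType) (n m : nat).
Local Notation V := (slSpace K n m).
Local Notation e := (slVec K n m).
Local Notation br := (@slBracket K n m).
Local Notation g := (SL K n m).
Local Notation ad := (adjoint g).
Local Notation wt := (wt K).
Local Notation eT := (eT K n m).
Local Notation ad_d1 := (@ad_d1 K n m).
Implicit Types (u v w : V) (x y z : gen).

Lemma br_basis x y : valid n m x -> valid n m y ->
  br (e x) (e y) = slBracket0 K n m x y - slBracket0 K n m y x.
Proof. by move=> /validP[a <-] /validP[b <-]; exact: bilinearExt_basis. Qed.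

Lemma br_X1X i : (1 < i)%N -> br (e (GX 1)) (e (GX i)) = e (GX i.+1).
Proof.
move=> i2; have [hi|hi] := boolP (valid n m (GX i)); last first.
  rewrite (vec_invalid K hi) linear0 vec_invalid //=.
  by move: hi; rewrite /=; lia.
rewrite br_basis //=; last by move: hi => /=; lia.
case: i i2 hi => [|[|i]] //= _ hi; rewrite subr0; case: ifP => // hi'.
by rewrite vec_invalid //=; lia.
Qed.

Lemma br_X1Y j : (0 < n)%N -> valid n m (GY j) ->
  br (e (GX 1)) (e (GY j)) = e (GY j.+1).
Proof.
move=> n0 hj; rewrite br_basis //= subr0; case: ifP => // hj'.
by rewrite vec_invalid //=; move: hj hj' => /=; lia.
Qed.

Lemma br_XX i j : (1 < i)%N -> (1 < j)%N -> br (e (GX i)) (e (GX j)) = 0.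
Proof.
move=> i2 j2; have [hi|hi] := boolP (valid n m (GX i)); last first.
  by rewrite (vec_invalid K hi) slBracket_skew linear0 oppr0.
have [hj|hj] := boolP (valid n m (GX j)); last first.
  by rewrite (vec_invalid K hj) linear0.
rewrite br_basis //; case: i i2 {hi} => [|[|i]] // _.
by case: j j2 {hj} => [|[|j]] // _; rewrite subrr.
Qed.

Lemma br_XY i j : (1 < i)%N -> br (e (GX i)) (e (GY j)) = 0.
Proof.
move=> i2; have [hi|hi] := boolP (valid n m (GX i)); last first.
  by rewrite (vec_invalid K hi) slBracket_skew linear0 oppr0.
have [hj|hj] := boolP (valid n m (GY j)); last first.
  by rewrite (vec_invalid K hj) linear0.
by rewrite br_basis //; case: i i2 {hi} => [|[|i]] // _; rewrite subrr.
Qed.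

Lemma br_YY i j : br (e (GY i)) (e (GY j)) = 0.
Proof. by apply: slBracket_odd; exact: (vec_hom K n m (GY _)). Qed.

Lemma coef_brX1 k v : (1 < k)%N -> valid n m (GX k) ->
  slCoef (GX k) (br (e (GX 1)) v) = (2 < k)%N%:R * slCoef (GX k.-1) v.
Proof.
move=> k2 hk; rewrite coef_bracket //= !coef_vec !eqE /=.
have h1 : (0 < n)%N by move: hk => /=; lia.
rewrite h1 (_ : (k == 1)%N = false); last by lia.
case: (ltnP 2 k) => k3.
  rewrite (_ : (k.-1 == 1)%N = false); last by lia.
  by rewrite /=; ring.
by rewrite /=; ring.
Qed.

Lemma coef_brX1Y k v : (0 < n)%N -> valid n m (GY k) ->
  slCoef (GY k) (br (e (GX 1)) v) = (1 < k)%N%:R * slCoef (GY k.-1) v.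
Proof.
move=> n0 hk; rewrite coef_bracket //= !coef_vec !eqE /=.
by rewrite n0 /=; ring.
Qed.

Lemma coef_brXX i v : (1 < i)%N -> valid n m (GX i.+1) ->
  slCoef (GX i.+1) (br (e (GX i)) v) = - slCoef (GX 1) v.
Proof.
move=> i2 hk; rewrite coef_bracket //= !coef_vec !eqE /=.
have hi : (0 < i <= n)%N by move: hk => /=; lia.
rewrite !eqxx hi ?i2.
rewrite (_ : (1 == i)%N = false); last by lia.
rewrite (_ : (i.+1 == i)%N = false); last by lia.
rewrite (_ : (2 < i.+1)%N = true) //.
by rewrite /=; ring.
Qed.

Lemma coef_brYX j v : valid n m (GY j) -> valid n m (GY j.+1) ->
  slCoef (GY j.+1) (br (e (GY j)) v) = - slCoef (GX 1) v.
Proof.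
move=> hj hk; rewrite coef_bracket //= !coef_vec !eqE /= eqxx.
rewrite (_ : (j.+1 == j)%N = false); last by lia.
rewrite (_ : (0 < j <= m)%N = true) // (_ : (1 < j.+1)%N = true);
  last by move: hj => /=; lia.
by rewrite /=; ring.
Qed.

Lemma coef_br_diag x v : valid n m x ->
  slCoef x (br (e x) v) = - \sum_l wt x l * slCoef (GT l.+1) v.
Proof.
move=> hx; rewrite coef_bracket // !big_ord_recl big_ord0.
case: x hx => k hk /=; rewrite ?ffunE /= ?coef_vec ?eqE /= ?eqxx /bump /=.
- rewrite [(0 < k <= n)%N]hk (_ : (k.-1 == k)%N = false);
    last by move: hk => /=; lia.
  have [k1|k1] := eqVneq k 1%N; last by rewrite /=; ring.
  by move: hk; rewrite k1 /= => ->; ring.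
- by ring.
- rewrite [(0 < k <= m)%N]hk (_ : (k.-1 == k)%N = false);
    last by move: hk => /=; lia.
  by rewrite /=; ring.
Qed.
End BasisBrackets.

(** * The cocycles c1 and c2 *)

Section Wedges.
Variables (K : fieldType) (n m : nat).
Local Notation V := (slSpace K n m).
Local Notation e := (slVec K n m).
Local Notation br := (@slBracket K n m).
Local Notation g := (SL K n m).
Local Notation ad := (adjoint g).
Implicit Types (u v w : V) (x y z : gen).

(** Wedge of the coordinate forms of X_1 and y, times the vector w. *)
Definition wedge y w u v : V :=
  (slCoef (GX 1) u * slCoef y v - slCoef y u * slCoef (GX 1) v) *: w.

Lemma bilinearExt_wedge (F : gen -> gen -> V) y w :
  (forall a b, F a b = ((a == GX 1) && (b == y))%:R *: w
                       - ((a == y) && (b == GX 1))%:R *: w) ->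
  bilinearExt F = wedge y w.
Proof.
move=> FE; apply/funext => u; apply/funext => v.
have prodE s t : (slCoef s u * slCoef t v) *: w = \sum_a \sum_b
    (slCoord a u * slCoord b v) *:
      (((slName a == s) && (slName b == t))%:R *: w).
  rewrite /slCoef big_distrlr scaler_suml; apply: eq_bigr => a _.
  rewrite scaler_suml; apply: eq_bigr => b _ /=.
  by rewrite scalerA -mulnb natrM mulrACA mulrC.
rewrite /wedge scalerBl !prodE -sumrB; apply: eq_bigr => a _.
by rewrite -sumrB; apply: eq_bigr => b _; rewrite FE scalerBr.
Qed.

Lemma c1_wedge p : c1 K n m p = wedge (GY p) (e (GY 1)).
Proof.
apply: bilinearExt_wedge => -[[|[|a]]|a|a] [[|[|b]]|b|b];
  rewrite ?eqE /= ?eqE /=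
  ?andbT ?andbF ?scale0r ?subr0 ?sub0r //.
- by case: eqn; rewrite ?scale1r ?scale0r.
- by case: eqn; rewrite ?scale1r ?scale0r ?oppr0.
Qed.

Lemma c2_wedge p : (0 < p)%N -> c2 K n m p = wedge (GX p.+1) (e (GX 2)).
Proof.
case: p => // p _.
apply: bilinearExt_wedge => -[[|[|a]]|a|a] [[|[|b]]|b|b];
  rewrite ?eqE /= ?eqE /=
  ?andbT ?andbF ?scale0r ?subr0 ?sub0r //.
- by case: eqn; rewrite ?scale1r ?scale0r.
- by case: eqn; rewrite ?scale1r ?scale0r ?oppr0.
Qed.

Lemma wedge_linearr y w u : linear (wedge y w u).
Proof.
move=> a v t; rewrite /wedge !(slCoefD, slCoefZ) scalerA -scalerDl.
by congr (_ *: _); ring.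
Qed.

Lemma wedge_linearl y w v : linear (wedge y w ^~ v).
Proof.
move=> a u t; rewrite /wedge !(slCoefD, slCoefZ) scalerA -scalerDl.
by congr (_ *: _); ring.
Qed.

Lemma wedge_skew y w u v : wedge y w u v = - wedge y w v u.
Proof. by rewrite /wedge -scaleNr; congr (_ *: _); ring. Qed.

Lemma coef_odd x (h : slOdd K m) : ~~ gen_odd x -> slCoef x ((0, h) : V) = 0.
Proof.
by case: x => k // _; have [] := @coef_oddXT K n m (0, h) k erefl.
Qed.

Lemma wedge_odd y w (h k : slOdd K m) : wedge y w (0, h) (0, k) = 0.
Proof. by rewrite /wedge !(@coef_odd (GX 1)) // mul0r mulr0 subrr scale0r. Qed.

Lemma wedge_super_alternating y w : super_alternating (A := ad) (wedge y w).
Proof.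
split; [split|move=> x|move=> h k].
- exact: wedge_linearr.
- exact: wedge_linearl.
- by rewrite /wedge mulrC subrr scale0r.
- by rewrite /oinj !wedge_odd.
Qed.

Lemma span2_sum (M : lmodType K) (w w' : M) a1 a2 a3 a4 a5 a6 p4 p5 p6
    q4 q5 q6 :
  a1 *: w + a2 *: w - a3 *: w - a4 *: (p4 *: w' + q4 *: w)
    + a5 *: (p5 *: w' + q5 *: w) - a6 *: (p6 *: w' + q6 *: w)
  = (a1 + a2 - a3 - a4 * q4 + a5 * q5 - a6 * q6) *: w
    + (- (a4 * p4) + a5 * p5 - a6 * p6) *: w'.
Proof.
have regroup (t y1 z1 y2 z2 y3 z3 : M) :
    (t - z1 + z2 - z3) + (- y1 + y2 - y3)
    = t - (y1 + z1) + (y2 + z2) - (y3 + z3).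
  rewrite [LHS]addrACA [X in X + _]addrACA (addrAC t).
  by rewrite (addrC z2) (addrC (- z3)) !opprD !addrA.
rewrite !(scalerDl, scaleNr, scalerDr, scalerA).
by rewrite regroup.
Qed.

(** The first hypothesis says how the form y transforms under brackets (tau is
    its infinitesimal character under the torus), the second that the torus acts
    on w by tau plus the weight of X_1, that is, by the weight of the product of
    the two forms.  The remaining terms X_1(u) y' and X_1(u) w' drop out because
    X_1 is wedged with itself.  Odd elements kill w, and the wedge vanishes on
    pairs of odd elements, hence no term with two or three odd arguments is
    left. *)
Lemma wedge_isCocycle y w w' (y' tau : V -> K) :
  (forall u v, slCoef y (br u v) = slCoef (GX 1) u * y' v
     - slCoef (GX 1) v * y' u + tau u * slCoef y v - tau v * slCoef y u) ->
  (forall u, br u w = slCoef (GX 1) u *: w'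
     + (tau u + slCoef (GT 1) u) *: w) ->
  (forall h : slOdd K m, tau (0, h) = 0) ->
  isCocycle 2 (cochain2 ad (wedge y w)).
Proof.
move=> yE wE tau_odd; have fA := wedge_super_alternating y w.
set f := wedge y w in fA *; have fC := isCochain_cochain2 fA.
have lie u v t : f (br u v) t + f v (br u t) - f u (br v t)
    - br u (f v t) + br v (f u t) - br t (f u v) = 0.
  rewrite /f /wedge ![br _ (_ *: w)]linearZ /= !wE !yE !coef_slBracketX1.
  rewrite span2_sum; set a := (X in X *: w + _); set b := (X in _ + X *: w').
  have -> : a = 0 by rewrite /a; ring.
  have -> : b = 0 by rewrite /b; ring.
  by rewrite !scale0r addr0.
have fskew u v : f u v = - f v u by exact: wedge_skew.
have odd0 (h : slOdd K m) (a : K) : br (0, h) (a *: w) = 0.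
  by rewrite linearZ /= wE tau_odd !coef_odd // add0r !scale0r addr0 scaler0.
have brodd (h k : od g) : sbr (oinj h) (oinj k) = 0 :> carrier g.
  exact: slBracket_odd.
have f0l (u : carrier g) : f 0 u = 0 :> mcarrier ad.
  exact: (linear_zero (wedge_linearl y w u)).
have f_odd (h k : od g) : f (oinj h) (oinj k) = 0 :> mcarrier ad.
  exact: wedge_odd.
have act_odd (h : od g) (u v : carrier g) :
  br (oinj h) (f u v) = 0 :> mcarrier ad by exact: odd0.
have br0 (u : carrier g) : br u (0 : mcarrier ad) = 0 :> mcarrier ad.
  exact: linear0.
split=> //; apply/funext => gs; apply/funext => hs.
have [sz|sz] := eqVneq (size gs + size hs)%N 3%N; last first.
  exact: (differential_size fC sz).
case: gs hs sz => [|x [|y0 [|z [|? gs]]]] [|h [|k [|l [|? hs]]]] // _.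
- rewrite differential_ooo /= !einj_sbr_oo !brodd !f0l !act_odd.
  by rewrite !addr0 subr0.
- rewrite differential_eoo /= einj_sbr_oo brodd f0l !f_odd br0 !act_odd.
  by rewrite !addr0 subr0.
- rewrite differential_eeo /= einj_sbr_ee !oinj_sbr_eo.
  exact: lie.
- rewrite differential_eee /= !einj_sbr_ee.
  have := lie (einj (g := g) x) (einj (g := g) y0) (einj (g := g) z).
  rewrite (fskew _ (br (einj (g := g) x) (einj (g := g) z))).
  rewrite (fskew _ (br (einj (g := g) y0) (einj (g := g) z))) opprK.
  exact.
Qed.
End Wedges.

(** * Cocycles of weight zero *)

Section ZeroWeightCocycles.
Variables (p : nat) (K : fieldType) (n m : nat).
Hypotheses (p2 : (2 < p)%N) (pK : p \in [pchar K]).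
Hypotheses (hn : (1 < n <= p.+1)%N) (hm : (1 <= m <= p)%N).
Local Notation V := (slSpace K n m).
Local Notation e := (slVec K n m).
Local Notation br := (@slBracket K n m).
Local Notation g := (SL K n m).
Local Notation ad := (adjoint g).
Local Notation wt := (wt K).
Local Notation eT := (eT K n m).
Local Notation ad_d1 := (@ad_d1 K n m).
Local Notation valid := (valid n m).
Implicit Types (u v w : V) (x y z : gen).

Lemma eqGX i j : (GX i == GX j) = (i == j). Proof. by []. Qed.

Lemma eqGY i j : (GY i == GY j) = (i == j). Proof. by []. Qed.

Lemma natr_eq_mod i j : (i <= j)%N -> i%:R = j%:R :> K ->
  exists q, j = (i + q * p)%N.
Proof.
move=> ij /eqP; rewrite eq_sym -subr_eq0 -natrB // -(dvdn_pcharf pK).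
by move=> /dvdnP[q hq]; exists q; rewrite -hq; lia.
Qed.

(** In characteristic p an integer is determined by its image in K within any p
    consecutive integers; the ranges used are those of the indices of
    X_2, ..., X_(p+1) and of Y_1, ..., Y_p. *)
Lemma natr_eq_small a i j : (a <= i < a + p)%N -> (a <= j < a + p)%N ->
  i%:R = j%:R :> K -> i = j.
Proof.
have wlog_le i' j' : (i' <= j')%N -> (a <= i' < a + p)%N ->
    (a <= j' < a + p)%N -> i'%:R = j'%:R :> K -> i' = j'.
  move=> ij hi hj /(natr_eq_mod ij)[[|q] hq]; first by lia.
  by move: hq; rewrite mulSn; lia.
move=> hi hj ij; have [le|le] := leqP i j; first exact: wlog_le.
exact: esym (wlog_le _ _ (ltnW le) hj hi (esym ij)).
Qed.

Lemma natr2_neq0 : 2%:R != 0 :> K.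
Proof. by rewrite -(dvdn_pcharf pK); apply/negP => /dvdn_leq; lia. Qed.

Lemma natr2_neq1 : 2%:R != 1 :> K.
Proof. by rewrite mulr2n -subr_eq0 addrK oner_eq0. Qed.

(** The three entries of the weight. *)
Definition w1 x : K := match x with GX k | GY k => k%:R | GT _ => 0 end.
Definition w2 x : K := if x is GX k then (1 < k)%N%:R else 0.
Definition w3 x : K := if x is GY _ then 1 else 0.

Lemma wt_eqP x y z :
  reflect [/\ w1 x + w1 y = w1 z, w2 x + w2 y = w2 z & w3 x + w3 y = w3 z]
    (wt x + wt y == wt z).
Proof.
have E1 t (hl : (0 < 3)%N) : wt t (Ordinal hl) = w1 t.
  by case: t => k; rewrite /= !ffunE.
have E2 t (hl : (1 < 3)%N) : wt t (Ordinal hl) = w2 t.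
  by case: t => k; rewrite /= !ffunE.
have E3 t (hl : (2 < 3)%N) : wt t (Ordinal hl) = w3 t.
  by case: t => k; rewrite /= !ffunE.
apply: (iffP eqP) => [/ffunP h|[h1 h2 h3]].
  have := h (@Ordinal 3 0 isT); have := h (@Ordinal 3 1 isT).
  by have := h (@Ordinal 3 2 isT); rewrite !ffunE !E1 !E2 !E3.
by apply/ffunP => -[[|[|[|//]]] hl]; rewrite ffunE ?E1 ?E2 ?E3.
Qed.

Lemma wt_inj y z : valid y -> valid z -> (forall k, y != GT k) ->
  wt y = wt z -> z = y.
Proof.
move=> hy hz hT hw; have /wt_eqP[] : wt (GT 1) + wt y == wt z.
  by rewrite add0r hw.
case: y hy hT {hw} => k hk hT; last 2 first.
- by have := hT k; rewrite eqxx.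
- case: z hz => k' hk' /=; rewrite !add0r => h1 _ /eqP h3;
    rewrite ?oner_eq0 // in h3.
  by congr GY; apply/esym/(natr_eq_small (a := 1)) => //;
    move: hk hk' => /=; lia.
- case: z hz => k' hk' /=; rewrite !add0r => h1 h2 /eqP h3.
  + case: (ltnP 1 k) (ltnP 1 k') h2 => k2 [] k2' /= /eqP h2;
      rewrite ?oner_eq0 1?eq_sym ?oner_eq0 // in h2.
      congr GX; apply/esym/(natr_eq_small (a := 2)) => //;
        by move: hk hk' => /=; lia.
    by congr GX; move: hk hk' => /=; lia.
  + move: h2 h1; case: ltnP => k2 /eqP; first by rewrite oner_eq0.
    have -> : k = 1%N by move: hk => /=; lia.
    by move=> _ /eqP; rewrite oner_eq0.
  + by rewrite eq_sym oner_eq0 in h3.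
Qed.

(** The second alternative is the wrap-around 1 + (p + 1) = 2 modulo p that
    makes room for c2. *)
Lemma wt_X1X i k : (1 < i)%N -> valid (GX i) -> valid (GX k) ->
  (wt (GX 1) + wt (GX i) == wt (GX k))
  = (k == i.+1) || (i == p.+1) && (k == 2).
Proof.
move=> i2 hi hk; have p0 := pcharf0 pK.
apply/wt_eqP/orP => /= [[h1 h2 _]|].
  have k2 : (1 < k)%N.
    by move: h2; rewrite i2 add0r; case: ltnP => // _ /eqP; rewrite oner_eq0.
  have [ip|ip] := eqVneq i p.+1; [right|left]; apply/eqP.
    apply: (natr_eq_small (a := 2)); [by move: hk => /=; lia|by lia|].
    by rewrite -h1 ip -[p.+1%:R]natr1 p0 add0r.
  apply: (natr_eq_small (a := 2)); [by move: hk => /=; lia| |].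
    by move: hi => /=; lia.
  by rewrite -h1 -[RHS]natr1 addrC.
case=> [/eqP->|/andP[/eqP-> /eqP->]]; split; rewrite ?addr0 ?add0r //.
- by rewrite -[RHS]natr1 addrC.
- by rewrite i2 (_ : (1 < i.+1)%N) //; lia.
- by rewrite -[p.+1%:R]natr1 p0 add0r.
- by rewrite (_ : (1 < p.+1)%N) //; lia.
Qed.

(** The second alternative is the wrap-around 1 + p = 1 modulo p that makes room
    for c1. *)
Lemma wt_X1Y j k : valid (GY j) -> valid (GY k) ->
  (wt (GX 1) + wt (GY j) == wt (GY k)) = (k == j.+1) || (j == p) && (k == 1%N).
Proof.
move=> hj hk; have p0 := pcharf0 pK.
apply/wt_eqP/orP => /= [[h1 _ _]|].
  have [jp|jp] := eqVneq j p; [right|left]; apply/eqP.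
    apply: (natr_eq_small (a := 1)); [by move: hk => /=; lia|by lia|].
    by rewrite -h1 jp p0 addr0.
  apply: (natr_eq_small (a := 1)); [by move: hk => /=; lia| |].
    by move: hj => /=; lia.
  by rewrite -h1 -[RHS]natr1 addrC.
case=> [/eqP->|/andP[/eqP-> /eqP->]]; split; rewrite ?addr0 ?add0r //.
- by rewrite -[RHS]natr1 addrC.
- by rewrite p0 addr0.
Qed.

Lemma wt_false x y z :
  (w2 x + w2 y != w2 z) || (w3 x + w3 y != w3 z) ->
  (wt x + wt y == wt z) = false.
Proof. by move=> h; apply/wt_eqP => -[_ h2 h3]; rewrite h2 h3 !eqxx in h. Qed.

(** This is where p > 2 is needed: in characteristic 2 the weight 1 + 1 would
    be that of the torus. *)
Lemma w2_2 z : 1 + 1 != w2 z.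
Proof.
case: z => k /=; rewrite ?natr2_neq0 //; case: (1 < k)%N => /=;
  by rewrite ?natr2_neq0 ?natr2_neq1.
Qed.

Lemma w3_2 z : 1 + 1 != w3 z.
Proof. by case: z => k /=; rewrite ?natr2_neq0 ?natr2_neq1. Qed.

Variable f : V -> V -> V.
Hypothesis fA : super_alternating (A := ad) f.
Hypothesis df : differential (cochain2 ad f) = 0.

Let linr u : linear (f u) := (sa_bilinear fA).1 u.
Let linl v : linear (f^~ v) := (sa_bilinear fA).2 v.

Lemma cartan0 l x y z : gen_odd x ==> gen_odd y -> wt x + wt y = wt z ->
  slCoef z (ad_d1 (f (eT l)) (e x) (e y)) = 0.
Proof.
by move=> hxy hw; rewrite (cartan_weight _ fA df hxy) hw subrr ffunE mul0r.
Qed.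

(* The scalars mu l x describe the component T_l, x -> x of f. *)
Let mu l x : K := slCoef x (f (eT l) (e x)).

(** The cocycle equation at (T_k, T_l, x) says that the torus component of
    f (T_k, T_l) acts on x by zero. *)
Lemma f_TT_aux k l x : valid x ->
  \sum_r wt x r * slCoef (GT r.+1) (f (eT k) (eT l)) = 0.
Proof.
move=> hx; have := @cartan0 k (GT l.+1) x x isT (add0r _).
rewrite (coef_ad_d1_vec _ _ _ (linr _)) -/(eT l) brT coef_brT expr0 mul1r.
rewrite coef_br_diag //.
have -> : f (eT k) (wt x l *: e x) = wt x l *: f (eT k) (e x).
  have := linr (eT k) (wt x l) (e x) 0; rewrite /= !addr0 => ->.
  by rewrite (linear_zero (linr _)) addr0.
by rewrite slCoefZ subrr add0r => /eqP; rewrite oppr_eq0 => /eqP.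
Qed.

(** The weights of X_1, X_2 and Y_1 are linearly independent, so the torus acts
    faithfully. *)
Lemma f_TT k l (r : 'I_3) : slCoef (GT r.+1) (f (eT k) (eT l)) = 0.
Proof.
have := @f_TT_aux k l (GX 1); have := @f_TT_aux k l (GX 2).
have := @f_TT_aux k l (GY 1); rewrite !big_ord_recl !big_ord0 /= !ffunE /=.
rewrite /bump /= !(mul0r, mul1r, addr0, add0r) => hY hX2 hX1.
have t1 := hX1 (ltac:(lia)); have := hX2 (ltac:(lia)); have := hY (ltac:(lia)).
rewrite !t1 !(mulr0, add0r) => t3 t2.
by case: r => [[|[|[|r]]] hr].
Qed.

(** The contraction of f by T_l is a derivation on components of weight zero:
    the eigenvalue at the bracket of X_1 and X_i is the sum of the two
    eigenvalues. *)
Lemma mu_X l i : (1 < i)%N -> valid (GX i.+1) ->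
  mu l (GX i.+1) = mu l (GX i) + mu l (GX 1).
Proof.
move=> i2 hi; have hw : wt (GX 1) + wt (GX i) = wt (GX i.+1).
  apply/eqP/wt_eqP; split; rewrite /= ?addr0 //.
    by rewrite -[RHS]natr1 [LHS]addrC.
  by rewrite i2 add0r (_ : (1 < i.+1)%N) //; lia.
have := @cartan0 l (GX 1) (GX i) (GX i.+1) isT hw.
rewrite (coef_ad_d1_vec _ _ _ (linr _)) br_X1X // coef_brX1 //; last by lia.
rewrite coef_brXX // (_ : (2 < i.+1)%N) // /= !mul1r /mu.
by move=> /eqP; rewrite -addrA -opprD subr_eq0 => /eqP.
Qed.

Lemma mu_Y l j : valid (GY j) -> valid (GY j.+1) ->
  mu l (GY j.+1) = mu l (GY j) + mu l (GX 1).
Proof.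
move=> hj hj'; have hw : wt (GX 1) + wt (GY j) = wt (GY j.+1).
  apply/eqP/wt_eqP; split; rewrite /= ?addr0 ?add0r //.
  by rewrite -[RHS]natr1 [LHS]addrC.
have := @cartan0 l (GX 1) (GY j) (GY j.+1) isT hw.
have n0 : (0 < n)%N by lia.
rewrite (coef_ad_d1_vec _ _ _ (linr _)) br_X1Y // coef_brX1Y //.
rewrite coef_brYX // (_ : (1 < j.+1)%N) /= ?expr0 ?mul1r /mu;
  last by move: hj => /=; lia.
by move=> /eqP; rewrite -addrA -opprD subr_eq0 => /eqP.
Qed.

(* The coordinates of the element of the torus whose action has the eigenvalues
   mu l; they are read off from X_1, X_2 and Y_1, which generate the span of
   the X_i and Y_j. *)
Let s l (r : 'I_3) : K := [:: mu l (GX 1); mu l (GX 2) - 2%:R * mu l (GX 1);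
  mu l (GY 1) - mu l (GX 1)]`_r.

Lemma mu_inner l x : valid x -> (forall k, x != GT k) ->
  mu l x = \sum_r wt x r * s l r.
Proof.
rewrite !big_ord_recl big_ord0; case: x => k hk hT; last 2 first.
- by have := hT k; rewrite eqxx.
- rewrite /= !ffunE /= /s /bump /= addr0 mul0r add0r mul1r.
  elim: k hk {hT} => [//|[|k] IH] hk; first by ring.
  rewrite mu_Y // ?IH; try by move: hk => /=; lia.
  by rewrite -[k.+2%:R]natr1; ring.
- rewrite /= !ffunE /= /s /bump /= addr0 mul0r addr0.
  elim: k hk {hT} => [//|[|[|k]] IH] hk; rewrite /=; try by ring.
  rewrite mu_X // IH /=; last by move: hk => /=; lia.
  by rewrite -[k.+3%:R]natr1; ring.
Qed.

(* Partial sums of the components X_1, X_i -> X_(i+1) of f: the diagonal map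
   with these eigenvalues has those components as its coboundary, X_1 being
   mapped to zero. *)
Let beta k : K := \sum_(2 <= i < k) slCoef (GX i.+1) (f (e (GX 1)) (e (GX i))).
Let beta' k : K := \sum_(1 <= i < k) slCoef (GY i.+1) (f (e (GX 1)) (e (GY i))).

(* The coboundary at (T_l, x) is the bracket of x with the image of T_l, hence
   the minus sign; the factor (valid x) makes the value 0 at names of no basis
   element. *)
Let correction_gen x : V := match x with
  | GX k => beta k *: e x
  | GT k => (valid x)%:R *: - \sum_r s (inord k.-1) r *: eT r
  | GY k => beta' k *: e x
  end.

Let correction : V -> V := linext (fun b => correction_gen (slName b)).

Let correction_linear : linear correction := linext_linear _.

Lemma correction_vec x : correction (e x) = correction_gen x.
Proof.
apply: linext_vec => y hy; case: y hy => k hk; rewrite /correction_gen.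
- by rewrite vec_invalid ?scaler0.
- by rewrite (negbTE hk) scale0r.
- by rewrite vec_invalid ?scaler0.
Qed.

Lemma correction_T l : correction (eT l) = - \sum_r s l r *: eT r.
Proof. by rewrite correction_vec /= ltn_ord scale1r inord_val. Qed.

(** On eigenvectors the coboundary of a linear map measures how far its
    eigenvalues are from being additive. *)
Lemma ad_d1_diag (phi : V -> V) x y a b c : linear phi ->
  gen_odd x ==> gen_odd y ->
  phi (e x) = a *: e x -> phi (e y) = b *: e y ->
  phi (br (e x) (e y)) = c *: br (e x) (e y) ->
  ad_d1 phi (e x) (e y) = (c - a - b) *: br (e x) (e y).
Proof.
move=> lin hxy hx hy hc; rewrite ad_d1_vec // hx hy hc !linearZ /=.
rewrite [br (e y) _]slBracket_skew.
have -> : (-1) ^+ gen_odd x *: - br (e x) (e y) = - br (e x) (e y).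
  case: x y hxy {hx hy hc} => [k|k|k] [k'|k'|k'] //= _;
    by rewrite ?br_YY ?expr0 ?scale1r // oppr0 scaler0.
have comb (M : lmodType K) (w : M) :
    c *: w + b *: - w + a *: - w = (c - a - b) *: w.
  by rewrite !scalerN !scalerBl addrAC.
exact: comb.
Qed.

Lemma ad_d1_correction_TT k l : ad_d1 correction (eT k) (eT l) = 0.
Proof.
have br0 l' k' : br (eT l') (correction (eT k')) = 0.
  rewrite correction_T (linearN (br _)) (linear_sum (br _)) big1 ?oppr0 //.
  move=> r _.
  by rewrite /= brZr brT ffunE scale0r scaler0.
rewrite ad_d1_vec // -/(eT l) -/(eT k) !br0 brT ffunE scale0r scaler0.
by rewrite (linear_zero correction_linear) subrr addr0.
Qed.

Lemma ad_d1_correction_T l y b : valid y -> (forall k, y != GT k) ->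
  correction (e y) = b *: e y ->
  ad_d1 correction (eT l) (e y) = mu l y *: e y.
Proof.
move=> hy hT hb; rewrite ad_d1_vec // brT.
have -> : correction (wt y l *: e y) = wt y l *: (b *: e y).
  have := correction_linear (wt y l) (e y) 0; rewrite !addr0 => ->.
  by rewrite (linear_zero correction_linear) addr0 hb.
rewrite -/(eT l) hb brZr brT [b *: (_ *: _)]scalerA [b * _]mulrC -scalerA.
rewrite subrr add0r.
rewrite correction_T (linearN (br _)) (linear_sum (br _)) expr0 scale1r /=.
rewrite -sumrN.
rewrite mu_inner // scaler_suml; apply: eq_bigr => r _.
by rewrite brZr slBracket_skew brT scalerN opprK scalerA mulrC.
Qed.

(* The two wrap-around components of f; kappa1 is zero unless m = p, and kappa2
   unless n = p + 1. *)
Let kappa1 : K := slCoef (GY 1) (f (e (GX 1)) (e (GY p))).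
Let kappa2 : K := slCoef (GX 2) (f (e (GX 1)) (e (GX p.+1))).

Let exotic u v : V := kappa1 *: wedge (GY p) (e (GY 1)) u v
  + kappa2 *: wedge (GX p.+1) (e (GX 2)) u v.

Let normal_form u v : V := ad_d1 correction u v + exotic u v.

(* The normal form agrees at (x, y) with the part of weight zero of f. *)
Let matches x y : Prop := forall z, valid z ->
  slCoef z (normal_form (e x) (e y)) =
  (wt x + wt y == wt z)%:R * slCoef z (f (e x) (e y)).

Let n0 : (0 < n)%N. Proof. by lia. Qed.

Lemma wedge_vec a w x y : valid x -> valid y ->
  wedge a w (e x) (e y) = (((x == GX 1) && (y == a))%:R
    - ((x == a) && (y == GX 1))%:R) *: w.
Proof.
move=> hx hy; rewrite /wedge !coef_vec -!natrM !mulnb.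
congr ((_%:R - _%:R) *: _); rewrite /= ?n0 ?andbT ?[GX 1 == _]eq_sym.
  by case: (eqVneq y a) => [<-|_]; rewrite ?hy ?andbT.
by case: (eqVneq x a) => [<-|_]; rewrite ?hx ?andbT.
Qed.

Lemma exotic_vec x y : valid x -> valid y ->
  exotic (e x) (e y) =
    (kappa1 * (((x == GX 1) && (y == GY p))%:R
      - ((x == GY p) && (y == GX 1))%:R)) *: e (GY 1)
  + (kappa2 * (((x == GX 1) && (y == GX p.+1))%:R
      - ((x == GX p.+1) && (y == GX 1))%:R)) *: e (GX 2).
Proof. by move=> hx hy; rewrite /exotic !wedge_vec // !scalerA. Qed.

Lemma matches0 x y : normal_form (e x) (e y) = 0 ->
  (forall z, valid z -> (wt x + wt y == wt z) = false) -> matches x y.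
Proof. by move=> h hw z hz; rewrite h hw // slCoef0 mul0r. Qed.

Lemma exotic_T (l : 'I_3) y : valid y -> exotic (e (GT l.+1)) (e y) = 0.
Proof.
move=> hy; rewrite exotic_vec //; last by rewrite /= ltn_ord.
by rewrite !eqE /= !subrr !mulr0 !scale0r addr0.
Qed.

Lemma exotic_X1X i : (1 < i)%N -> valid (GX i) ->
  exotic (e (GX 1)) (e (GX i)) = (kappa2 * (i == p.+1)%:R) *: e (GX 2).
Proof.
move=> i2 hi; rewrite exotic_vec //.
rewrite !eqE /= subrr mulr0 scale0r add0r -!eqE.
by rewrite (_ : (1 == p.+1)%N = false) ?subr0 //; lia.
Qed.

Lemma exotic_X1Y j : valid (GY j) ->
  exotic (e (GX 1)) (e (GY j)) = (kappa1 * (j == p)%:R) *: e (GY 1).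
Proof.
move=> hj; rewrite exotic_vec //.
by rewrite !eqE /= ?andbF !subr0 mulr0 scale0r addr0.
Qed.

Lemma exotic_XX i j : (1 < i)%N -> (1 < j)%N -> valid (GX i) -> valid (GX j) ->
  exotic (e (GX i)) (e (GX j)) = 0.
Proof.
move=> i2 j2 hi hj; have ne k : (1 < k)%N -> (GX k == GX 1) = false.
  by move=> k2; apply/eqP => -[]; lia.
rewrite exotic_vec // !ne // !(andbF, andFb) /=.
by rewrite !subrr !mulr0 !scale0r addr0.
Qed.

Lemma exotic_Y x j : x != GX 1 -> valid x -> valid (GY j) ->
  exotic (e x) (e (GY j)) = 0.
Proof.
move=> /negbTE x1 hx hj; rewrite exotic_vec // x1 !(andbF, andFb) /=.
by rewrite !subrr !mulr0 !scale0r addr0.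
Qed.

Lemma matches_T l y : valid y -> matches (GT (l : 'I_3).+1) y.
Proof.
move=> hy; have hl : valid (GT l.+1) by rewrite /= ltn_ord.
case: (boolP (if y is GT _ then true else false)) => hT.
  case: y hy hT => // -[//|k] hk _ z hz.
  have k3 : (k < 3)%N by move: hk.
  rewrite /normal_form exotic_T // addr0.
  rewrite (_ : e (GT k.+1) = eT (Ordinal k3)) // -/(eT l) ad_d1_correction_TT.
  rewrite slCoef0; case: (boolP (_ == _)) => [/wt_eqP[h1 h2 h3]|];
    last by rewrite mul0r.
  move: h1 h2 h3; case: z hz => q hq /=; rewrite !addr0.
  - move=> /esym/eqP h1; case: ltnP => q2; move=> /esym/eqP.
      by rewrite oner_eq0.
    have q1 : q = 1%N by move: hq => /=; lia.
    by rewrite q1 oner_eq0 in h1.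
  - move=> _ _ _; case: q hq => // q hq; have q3 : (q < 3)%N by move: hq.
    by rewrite (f_TT _ _ (Ordinal q3)) mulr0.
  - by move=> _ _ /esym/eqP; rewrite oner_eq0.
have hT' k : y != GT k by case: y hT {hy}.
have [b hb] : exists b, correction (e y) = b *: e y.
  by case: y hT {hy hT'} => k // _; rewrite correction_vec /=; eexists.
move=> z hz; rewrite /normal_form exotic_T // addr0.
rewrite (ad_d1_correction_T _ hy hT' hb) slCoefZ coef_vec hz andbT.
rewrite [wt _ + wt y]add0r.
have [zy|zy] := eqVneq z y; first by rewrite zy eqxx mulr1 mul1r.
rewrite mulr0; case: eqP => [h|_]; last by rewrite mul0r.
by rewrite (wt_inj hy hz hT' h) eqxx in zy.
Qed.

Lemma normal_form_diag x y a b c : gen_odd x ==> gen_odd y ->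
  correction (e x) = a *: e x -> correction (e y) = b *: e y ->
  correction (br (e x) (e y)) = c *: br (e x) (e y) ->
  normal_form (e x) (e y) = (c - a - b) *: br (e x) (e y) + exotic (e x) (e y).
Proof.
by move=> hxy hx hy hc; rewrite /normal_form (ad_d1_diag _ hxy hx hy hc).
Qed.

Lemma matches_X1X i : (1 < i)%N -> valid (GX i) -> matches (GX 1) (GX i).
Proof.
move=> i2 hi z hz.
rewrite (@normal_form_diag (GX 1) (GX i) (beta 1) (beta i) (beta i.+1)) //;
  rewrite ?br_X1X ?correction_vec // exotic_X1X //.
have -> : beta i.+1 - beta 1 - beta i =
    slCoef (GX i.+1) (f (e (GX 1)) (e (GX i))).
  rewrite [beta 1]big_geq // subr0 [beta i.+1]big_nat_recr //= -/(beta i).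
  by rewrite [X in X - _]addrC addrK.
rewrite slCoefD !slCoefZ !coef_vec hz !andbT.
case: z hz => k hz; last 2 first.
- rewrite [wt _ + _ == _]wt_false ?mulr0 ?mul0r ?addr0 //.
  by rewrite /= i2 add0r oner_eq0.
- rewrite [wt _ + _ == _]wt_false ?mulr0 ?mul0r ?addr0 //.
  by rewrite /= i2 add0r oner_eq0.
rewrite wt_X1X // !eqGX.
have [->|ki] := eqVneq k i.+1; rewrite ?eqxx /=.
  rewrite (_ : (i.+1 == 2)%N = false); last by lia.
  by rewrite mulr0 addr0 mulr1 mul1r.
rewrite mulr0 add0r.
case: (eqVneq i p.+1) (eqVneq k 2%N) => [->|_] [->|_];
  by rewrite /= ?mulr0 ?mul0r ?mulr1 ?mul1r.
Qed.

Lemma matches_X1Y j : valid (GY j) -> matches (GX 1) (GY j).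
Proof.
move=> hj z hz.
rewrite (@normal_form_diag (GX 1) (GY j) (beta 1) (beta' j) (beta' j.+1)) //;
  rewrite ?br_X1Y ?correction_vec // exotic_X1Y //.
have -> : beta' j.+1 - beta 1 - beta' j =
    slCoef (GY j.+1) (f (e (GX 1)) (e (GY j))).
  have j0 : (0 < j)%N by move: hj => /=; lia.
  rewrite [beta 1]big_geq // subr0 [beta' j.+1]big_nat_recr //= -/(beta' j).
  by rewrite [X in X - _]addrC addrK.
rewrite slCoefD !slCoefZ !coef_vec hz !andbT.
case: z hz => k hz.
- rewrite [wt _ + _ == _]wt_false ?mulr0 ?mul0r ?addr0 //.
  by rewrite /= add0r oner_eq0 orbT.
- rewrite [wt _ + _ == _]wt_false ?mulr0 ?mul0r ?addr0 //.
  by rewrite /= add0r oner_eq0 orbT.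
rewrite wt_X1Y // !eqGY.
have [->|ki] := eqVneq k j.+1; rewrite ?eqxx /=.
  rewrite (_ : (j.+1 == 1)%N = false); last by move: hj => /=; lia.
  by rewrite mulr0 addr0 mulr1 mul1r.
rewrite mulr0 add0r.
case: (eqVneq j p) (eqVneq k 1%N) => [->|_] [->|_];
  by rewrite /= ?mulr0 ?mul0r ?mulr1 ?mul1r.
Qed.

Lemma normal_form_commuting x y a b : gen_odd x ==> gen_odd y ->
  correction (e x) = a *: e x -> correction (e y) = b *: e y ->
  br (e x) (e y) = 0 -> exotic (e x) (e y) = 0 -> normal_form (e x) (e y) = 0.
Proof.
move=> hxy hx hy h0 h1; rewrite (@normal_form_diag _ _ a b 0) // h0 ?h1.
  by rewrite scaler0 addr0.
by rewrite (linear_zero correction_linear) scaler0.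
Qed.

Lemma matches_XX i j : (1 < i)%N -> (1 < j)%N -> valid (GX i) -> valid (GX j) ->
  matches (GX i) (GX j).
Proof.
move=> i2 j2 hi hj; apply: matches0 => [|z _].
  apply: (@normal_form_commuting (GX i) (GX j) (beta i) (beta j)) => //;
    by rewrite ?correction_vec ?br_XX ?exotic_XX.
by apply: wt_false; rewrite /w2 i2 j2 w2_2.
Qed.

Lemma matches_XY i j : (1 < i)%N -> valid (GX i) -> valid (GY j) ->
  matches (GX i) (GY j).
Proof.
move=> i2 hi hj; apply: matches0 => [|z _].
  apply: (@normal_form_commuting (GX i) (GY j) (beta i) (beta' j)) => //;
    rewrite ?correction_vec ?br_XY ?exotic_Y // eqGX; lia.
apply: wt_false; rewrite /= i2; case: z => k /=;
  by rewrite ?(addr0, add0r, oner_eq0, orbT).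
Qed.

Lemma matches_YY i j : valid (GY i) -> valid (GY j) -> matches (GY i) (GY j).
Proof.
move=> hi hj; apply: matches0 => [|z _].
  apply: (@normal_form_commuting (GY i) (GY j) (beta' i) (beta' j)) => //;
    by rewrite ?correction_vec ?br_YY ?exotic_Y.
by apply: wt_false; rewrite /w3 w3_2 orbT.
Qed.

Lemma vec_even x : ~~ gen_odd x -> e x = einj (g := g) (e x).1.
Proof.
by case: x => k // _; congr (_, _); apply/ffunP => b; rewrite !ffunE.
Qed.

Lemma matches_skew x y : ~~ gen_odd x -> ~~ gen_odd y ->
  matches x y -> matches y x.
Proof.
move=> hx hy hxy z hz; have := hxy z hz; rewrite [wt y + _]addrC.
have -> : f (e y) (e x) = - f (e x) (e y).
  by rewrite (vec_even hx) (vec_even hy); exact: (even_skew _ _ fA).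
have -> : normal_form (e y) (e x) = - normal_form (e x) (e y).
  rewrite /normal_form /exotic !(wedge_skew _ _ (e y)) !scalerN -opprD.
  rewrite [RHS]opprD.
  congr (_ + _); rewrite (vec_even hx) (vec_even hy).
  exact: (even_skew _ _ (super_alternating_d1 (A := ad) correction_linear)).
by rewrite !slCoefN mulrN => ->.
Qed.

Lemma matches_diag x : ~~ gen_odd x -> matches x x.
Proof.
move=> hx z hz.
have -> : f (e x) (e x) = 0 by rewrite (vec_even hx); exact: (sa_even fA).
have -> : normal_form (e x) (e x) = 0.
  rewrite /normal_form /exotic.
  have -> : ad_d1 correction (e x) (e x) = 0.
    rewrite (vec_even hx).
    exact: (sa_even (super_alternating_d1 (A := ad) correction_linear)).
  have w0 y w : wedge y w (e x) (e x) = 0 by rewrite /wedge mulrC subrr scale0r.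
  by rewrite !w0 !scaler0 !addr0.
by rewrite slCoef0 mulr0.
Qed.

Lemma matches_all x y : valid x -> valid y -> gen_odd x ==> gen_odd y ->
  matches x y.
Proof.
case: x => [i|l|j] hx; last 1 first.
- by case: y => // j' hy _; exact: matches_YY.
- have i1 : (1 < i)%N \/ i = 1%N by move: hx => /=; lia.
  case: y => [k|l|j] hy _.
  + have k1 : (1 < k)%N \/ k = 1%N by move: hy => /=; lia.
    case: i1 k1 hx hy => [i2|->] [k2|->] hx hy.
    * exact: matches_XX.
    * by apply: matches_skew => //; exact: matches_X1X.
    * exact: matches_X1X.
    * exact: matches_diag.
  + case: l hy => // l hy; apply: matches_skew => //.
    exact: (@matches_T (Ordinal (hy : l < 3)%N)).
  + by case: i1 hx => [i2|->] hx; [exact: matches_XY|exact: matches_X1Y].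
- by case: l hx => // l hl hy _; exact: (@matches_T (Ordinal (hl : l < 3)%N)).
Qed.

(** The primitive is the sum of the one for the nonzero weights and of the
    correction for weight zero. *)
Lemma cocycle_normal_form : exists phi a b, linear phi /\
  forall x y, valid x -> valid y -> gen_odd x ==> gen_odd y ->
    f (e x) (e y) = ad_d1 phi (e x) (e y) + (a *: c1 K n m p (e x) (e y)
      + b *: c2 K n m p (e x) (e y)).
Proof.
have [phi lin phiE] := weight_reduction fA df.
exists (phi \+ correction), kappa1, kappa2; split.
  move=> a u v /=; rewrite lin correction_linear scalerDr.
  by rewrite addrACA.
move=> x y hx hy hxy; rewrite c1_wedge c2_wedge; last by lia.
rewrite -/(exotic (e x) (e y)); apply: coefP => z hz.
have -> : ad_d1 (phi \+ correction) (e x) (e y) =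
    ad_d1 phi (e x) (e y) + ad_d1 correction (e x) (e y).
  exact: ad_d1D.
rewrite -addrA slCoefD phiE // (matches_all hx hy hxy hz) -mulrDl.
by case: (_ == _); rewrite ?addr0 ?add0r mul1r.
Qed.
End ZeroWeightCocycles.

(** * The second cohomology space *)

Section Classification.
Variables (p : nat) (K : fieldType) (n m : nat).
Local Notation V := (slSpace K n m).
Local Notation e := (slVec K n m).
Local Notation br := (@slBracket K n m).
Local Notation g := (SL K n m).
Local Notation ad := (adjoint g).
Local Notation ad_d1 := (@ad_d1 K n m).
Local Notation valid := (valid n m).
Local Notation k1 := (cochain2 ad (c1 K n m p)).
Local Notation k2 := (cochain2 ad (c2 K n m p)).
Implicit Types (u v w : V) (x y z : gen).

Lemma c1_isCocycle : p \in [pchar K] -> (0 < n)%N -> (0 < m)%N ->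
  isCocycle 2 k1.
Proof.
move=> pK n0 m0; have p0 := pcharf0 pK; have p1 := prime_gt1 (pcharf_prime pK).
rewrite c1_wedge; pose chi : K := (valid (GY p))%:R.
apply: (@wedge_isCocycle _ _ _ _ _ (e (GY 2))
  (fun v => chi * slCoef (GY p.-1) v) (fun u => slCoef (GT 3) u)).
- move=> u v; have [hp|hp] := boolP (valid (GY p)); last first.
    by rewrite !(coef_invalid _ hp) /chi (negbTE hp) /=; ring.
  rewrite /chi hp coef_bracket //= p0 (_ : (1 < p)%N = true); last by lia.
  by rewrite /=; ring.
(* The bracket with Y_1 is Y_2 for X_1 and a multiple of Y_1 for the torus. *)
- move=> u; apply: coefP => z hz; rewrite coef_bracket // slCoefD !slCoefZ.
  case: z hz => k hk; rewrite /= !coef_vec !eqE /= ?hk; [by ring|by ring|].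
  by case: k hk => [|[|[|k]]] //= hk; rewrite ?hk ?m0 ?n0 /=; ring.
- by move=> h; exact: coef_odd.
Qed.

Lemma c2_isCocycle : p \in [pchar K] -> (1 < n)%N -> isCocycle 2 k2.
Proof.
move=> pK n1; have p0 := pcharf0 pK; have p1 := prime_gt1 (pcharf_prime pK).
have n0 := ltnW n1; rewrite c2_wedge; last by lia.
pose chi : K := (valid (GX p.+1))%:R.
apply: (@wedge_isCocycle _ _ _ _ _ (e (GX 3))
  (fun v => chi * slCoef (GX p) v)
  (fun u => slCoef (GT 1) u + slCoef (GT 2) u)).
- move=> u v; have [hp|hp] := boolP (valid (GX p.+1)); last first.
    by rewrite !(coef_invalid _ hp) /chi (negbTE hp) /=; ring.
  rewrite /chi hp coef_bracket //= -[p.+1%:R]natr1 p0.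
  rewrite (_ : (2 < p.+1)%N = true); last by lia.
  rewrite (_ : (1 < p.+1)%N = true); last by lia.
  by rewrite /=; ring.
- move=> u; apply: coefP => z hz; rewrite coef_bracket // slCoefD !slCoefZ.
  case: z hz => k hk; rewrite /= !coef_vec !eqE /= ?hk; [|by ring|by ring].
  by case: k hk => [|[|[|[|k]]]] //= hk; rewrite ?hk ?n0 ?n1 /=; ring.
- by move=> h; rewrite !coef_odd // addr0.
Qed.

Lemma bilinear_eq (f f' : V -> V -> V) a b u v :
  (forall u, linear (f u)) -> (forall v, linear (f^~ v)) ->
  (forall u, linear (f' u)) -> (forall v, linear (f'^~ v)) ->
  (forall x y, valid x -> valid y -> gen_odd x ==> gen_odd y ->
     f (e x) (e y) = f' (e x) (e y)) ->
  Defs.hom a u -> Defs.hom b v -> a ==> b -> f u v = f' u v.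
Proof.
move=> lr ll lr' ll' ff' hu hv hab.
rewrite [LHS](linear_expansion u (ll v)) [RHS](linear_expansion u (ll' v)).
apply: eq_bigr => i _.
rewrite (linear_expansion v (lr _)) (linear_expansion v (lr' _)).
rewrite !scaler_sumr; apply: eq_bigr => j _.
have [hij|hij] := boolP (gen_odd (slName i) ==> gen_odd (slName j)).
  by rewrite ff' // valid_name.
suff : slCoord i u = 0 \/ slCoord j v = 0.
  by case=> ->; rewrite !scale0r // !scaler0.
case: i j hij => [i|i] [j|j]; rewrite /= ?implybT //; first by case: i.
move=> _; case: a b hab hu hv => -[] //= _ hu hv.
- by right; rewrite hv ffunE.
- by left; rewrite hu ffunE.
- by left; rewrite hu ffunE.
Qed.

(** A bilinear map enters [cochain2] only through pairs that are not
    (odd, even), so equality on such pairs of basis elements is enough. *)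
Lemma cochain2_eq (f f' : V -> V -> V) :
  (forall u, linear (f u)) -> (forall v, linear (f^~ v)) ->
  (forall u, linear (f' u)) -> (forall v, linear (f'^~ v)) ->
  (forall x y, valid x -> valid y -> gen_odd x ==> gen_odd y ->
     f (e x) (e y) = f' (e x) (e y)) ->
  cochain2 ad f = cochain2 ad f'.
Proof.
move=> lr ll lr' ll' ff'.
have E a b u v : Defs.hom a u -> Defs.hom b v -> a ==> b -> f u v = f' u v.
  exact: bilinear_eq.
apply/funext => -[|x [|y [|z gs]]]; apply/funext => -[|h [|k [|l hs]]] //=.
- exact: (E true true).
- exact: (E false true).
- exact: (E false false).
Qed.

Lemma linear_comb (F G H : V -> V) a b : linear F -> linear G -> linear H ->
  linear (fun u => F u + (a *: G u + b *: H u)).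
Proof.
move=> lF lG lH r u v; rewrite lF lG lH.
have comb (M : lmodType K) (x x' y y' z z' : M) :
    r *: x + x' + (a *: (r *: y + y') + b *: (r *: z + z'))
    = r *: (x + (a *: y + b *: z)) + (x' + (a *: y' + b *: z')).
  rewrite !scalerDr !scalerA [a * r]mulrC [b * r]mulrC.
  by rewrite [X in _ + X = _]addrACA [LHS]addrACA.
exact: comb.
Qed.

Lemma cochain2_comb (F G H : V -> V -> V) a b :
  cochain2 ad (fun u v => F u v + (a *: G u v + b *: H u v)) =
  cochain2 ad F + (a *: cochain2 ad G + b *: cochain2 ad H).
Proof.
have zero : 0 = 0 + (a *: 0 + b *: 0) :> mcarrier ad.
  by rewrite !scaler0 !addr0.
by apply/funext => -[|x [|y [|z gs]]]; apply/funext => -[|h [|k [|l hs]]];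
  rewrite /= ?preE //; exact: zero.
Qed.

Lemma cocycle_decomposition : (2 < p)%N -> p \in [pchar K] ->
  (1 < n <= p.+1)%N -> (1 <= m <= p)%N -> forall z : cocycle ad 2,
  exists a b, isCoboundary 2 (val z - (a *: k1 + b *: k2)).
Proof.
move=> p2 pK hn hm z.
have /asboolP[zC zd] := valP z.
have [f fA zE] := cochain2P zC; rewrite zE in zd.
have [phi [a [b [lin fE]]]] := cocycle_normal_form p2 pK hn hm fA zd.
exists a, b; exists (cochain1 (A := ad) phi).
  exact: isCochain_cochain1.
have [flr fll] := sa_bilinear fA.
have [dlr dll] := sa_bilinear (super_alternating_d1 (A := ad) lin).
rewrite (differential_cochain1 (A := ad) lin).
suff -> : val z = cochain2 ad (ad_d1 phi) + (a *: k1 + b *: k2).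
  by rewrite addrK.
rewrite zE -cochain2_comb; apply: cochain2_eq => // [u|v].
- apply: (@linear_comb (ad_d1 phi u)); first exact: dlr.
  + by move=> r s t; exact: bilinearExt_linearr.
  + by move=> r s t; exact: bilinearExt_linearr.
- apply: (@linear_comb (fun u => ad_d1 phi u v)); first exact: dll.
  + by move=> r s t; exact: bilinearExt_linearl.
  + by move=> r s t; exact: bilinearExt_linearl.
Qed.

Lemma vec_oinj j : e (GY j) = oinj (g := g) (e (GY j)).2.
Proof. by congr (_, _); apply/ffunP => -[i|i]; rewrite !ffunE. Qed.

(** The coordinate Y_1 of a coboundary at (X_1, Y_p), and X_2 at
    (X_1, X_(p+1)), vanishes: these two brackets are zero when m = p and
    n = p + 1, the bracket with X_1 never has a component Y_1 or X_2, and the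
    bracket with Y_p or X_(p+1) is a multiple of that element. *)
Lemma coboundary_coefs a b : (1 < p)%N -> (1 < n)%N ->
  isCoboundary 2 (a *: k1 + b *: k2) ->
  (m = p -> a = 0) /\ (n = p.+1 -> b = 0).
Proof.
move=> p1 n1 [c /cochain1P[phi lin ->]]; rewrite differential_cochain1 // => E.
have Eeo (x : ev g) (h : od g) :
    a *: c1 K n m p (einj x) (oinj h) + b *: c2 K n m p (einj x) (oinj h)
    = ad_d1 phi (einj x) (oinj h) :> V.
  exact: (congr1 (fun c : precochain ad => c [:: x] [:: h]) E).
have Eee (x y : ev g) :
    a *: c1 K n m p (einj x) (einj y) + b *: c2 K n m p (einj x) (einj y)
    = ad_d1 phi (einj x) (einj y) :> V.
  exact: (congr1 (fun c : precochain ad => c [:: x; y] [::]) E).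
have X1 : valid (GX 1) by move=> /=; lia.
have n0 : (0 < n)%N by lia.
split=> [mp|np].
- have Y1 : valid (GY 1) by move=> /=; lia.
  have Yp : valid (GY p) by move=> /=; lia.
  have := Eeo (e (GX 1)).1 (e (GY p)).2; rewrite -vec_even // -vec_oinj.
  move=> /(congr1 (slCoef (GY 1))); rewrite coef_ad_d1_vec // br_X1Y //.
  rewrite [e (GY p.+1)]vec_invalid ?(linear_zero lin) ?slCoef0;
    last by rewrite /=; lia.
  rewrite coef_brX1Y // mul0r subr0 add0r expr0 mul1r.
  rewrite c1_wedge c2_wedge; last by lia.
  rewrite /wedge !coef_vec slCoefD !slCoefZ !coef_vec X1 Y1 Yp !eqE /=.
  rewrite coef_bracket //= !coef_vec !eqE /=.
  rewrite ?eqnE eqxx (_ : (1%N == p) = false) /=; last by lia.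
  by rewrite !(mul0r, mulr0, mul1r, mulr1, addr0, subr0).
- have X2 : valid (GX 2) by move=> /=; lia.
  have Xp : valid (GX p.+1) by move=> /=; lia.
  have p1' : (1 < p.+1)%N by lia.
  have := Eee (e (GX 1)).1 (e (GX p.+1)).1; rewrite -!vec_even //.
  move=> /(congr1 (slCoef (GX 2))); rewrite coef_ad_d1_vec // br_X1X //.
  rewrite [e (GX p.+2)]vec_invalid ?(linear_zero lin) ?slCoef0;
    last by rewrite /=; lia.
  rewrite coef_brX1 // mul0r subr0 add0r expr0 mul1r.
  rewrite c1_wedge c2_wedge; last by lia.
  rewrite /wedge !coef_vec slCoefD !slCoefZ !coef_vec X1 X2 Xp !eqE /=.
  rewrite coef_bracket //= !coef_vec !eqE /= ?eqnE eqxx.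
  rewrite (_ : (p == 0)%N = false); last by lia.
  rewrite (_ : (1%N == p.+1) = false); last by lia.
  rewrite (_ : (2%N == p.+1) = false); last by lia.
  by rewrite /= !(mul0r, mulr0, mul1r, mulr1, add0r, addr0, subr0, oppr0).
Qed.

Lemma homogeneous_coef d u x : homogeneous d u -> valid x ->
  slCoef x u != 0 -> slDeg n x = d.
Proof. by move=> hu /validP[i <-]; rewrite coef_name => /hu. Qed.

(** The value of a wedge at (u, v) can be nonzero only if one of u, v has the
    degree of X_1 and the other one that of y. *)
Lemma wedge_degree y x d : valid (GX 1) -> valid y ->
  slDeg n x = 1%:Z + slDeg n y + d -> hasDegree d (wedge y (e x)).
Proof.
move=> X1 hy hx a b u v hu hv i; rewrite coordZ coord_vec mulf_eq0 negb_or.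
case/andP=> h; case: (slName i =P x) => [->|]; last by rewrite eqxx.
move=> _; rewrite hx; congr (_ + d).
have [h0|h0] := eqVneq (slCoef (GX 1) u * slCoef y v) 0.
  move: h; rewrite h0 sub0r oppr_eq0 mulf_eq0 negb_or => /andP[hy' h1].
  by rewrite -(homogeneous_coef hu hy hy') -(homogeneous_coef hv X1 h1) addrC.
move: h0; rewrite mulf_eq0 negb_or => /andP[h1 hy'].
by rewrite -(homogeneous_coef hv hy hy') -(homogeneous_coef hu X1 h1).
Qed.

Lemma c1_degree : (0 < n)%N -> (0 < p)%N -> m = p ->
  hasDegree (- p%:Z) (c1 K n m p).
Proof.
by move=> n0 p0 mp; rewrite c1_wedge; apply: wedge_degree => /=; lia.
Qed.

Lemma c2_degree : (0 < p)%N -> n = p.+1 -> hasDegree (- p%:Z) (c2 K n m p).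
Proof.
move=> p0 np; rewrite c2_wedge //.
by apply: wedge_degree => /=; lia.
Qed.

Lemma cochain2_wedge_invalid y w : ~~ valid y -> cochain2 ad (wedge y w) = 0.
Proof.
move=> hy; have w0 u v : wedge y w u v = 0.
  by rewrite /wedge !(coef_invalid _ hy) mul0r mulr0 subrr scale0r.
by apply/funext => -[|x [|y' [|z gs]]]; apply/funext => -[|h [|k [|l hs]]] //=;
  exact: w0.
Qed.

Lemma c1_zero : (m < p)%N -> k1 = 0.
Proof. by move=> mp; rewrite c1_wedge cochain2_wedge_invalid //=; lia. Qed.

Lemma c2_zero : (0 < p)%N -> (n < p.+1)%N -> k2 = 0.
Proof.
move=> p0 np; rewrite c2_wedge //.
by rewrite cochain2_wedge_invalid //=; lia.
Qed.
End Classification.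

Theorem claim6p1 (p : nat) (K : fieldType) (n m : nat)
  (hp : p \in [:: 3; 5; 7; 11]%N) (hK : p \in [pchar K])
  (hn : (1 < n <= p.+1)%N) (hm : (1 <= m <= p)%N) :
  let g := SL K n m in
  let A := adjoint g in
  let H2 := cohomology A 2 in
  let k1 := cochain2 A (c1 K n m p) in
  let k2 := cochain2 A (c2 K n m p) in
  [/\ (m < p)%N -> (n < p.+1)%N -> forall h : H2, h = 0,
      m = p -> (n < p.+1)%N ->
        hasDim H2 1 /\
        exists z1 : cocycle A 2, val z1 = k1 /\
          forall h : H2, exists a, h = a *: cohomClass z1,
      (m < p)%N -> n = p.+1 ->
        hasDim H2 1 /\
        exists z2 : cocycle A 2, val z2 = k2 /\
          forall h : H2, exists a, h = a *: cohomClass z2,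
      m = p -> n = p.+1 ->
        hasDim H2 2 /\
        exists z1 z2 : cocycle A 2, [/\ val z1 = k1, val z2 = k2 &
          forall h : H2, exists a b,
            h = a *: cohomClass z1 + b *: cohomClass z2]
    & (m = p -> hasDegree (- p%:Z) (c1 K n m p)) /\
      (n = p.+1 -> hasDegree (- p%:Z) (c2 K n m p))].
Proof.
have p2 : (2 < p)%N by move: hp; rewrite !inE => /or4P[]/eqP->.
have [p0 p1 n0 n1 m0] : [/\ 0 < p, 1 < p, 0 < n, 1 < n & 0 < m]%N by split; lia.
move=> g A H2 k1 k2.
have k1Z : k1 \in @Zpred K g A 2 by apply/asboolP; exact: c1_isCocycle.
have k2Z : k2 \in @Zpred K g A 2 by apply/asboolP; exact: c2_isCocycle.
pose z1 : cocycle A 2 := Sub k1 k1Z; pose z2 : cocycle A 2 := Sub k2 k2Z.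
have dec := cocycle_decomposition p2 hK hn hm.
have coefs a b := @coboundary_coefs p K n m a b p1 n1.
split; last by split; [exact: c1_degree|exact: c2_degree].
- move=> mp np; apply: cohom_ind => z; apply/cohomClass_eq0.
  have [a [b]] := dec z.
  by rewrite (c1_zero _ _ mp) (c2_zero _ _ p0 np) !scaler0 addr0 subr0.
- move=> mp np; have k20 : k2 = 0 by exact: c2_zero.
  have [z|a|dim span] := @cohomology_span1 _ _ _ _ z1.
  + have [a [b h]] := dec z; exists a.
    by move: h; rewrite -/k2 k20 scaler0 addr0.
  + have := coefs a 0; rewrite scale0r addr0 => h /h[h1 _]; exact: h1.
  + by split=> //; exists z1.
- move=> mp np; have k10 : k1 = 0 by exact: c1_zero.
  have [z|a|dim span] := @cohomology_span1 _ _ _ _ z2.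
  + have [a [b h]] := dec z; exists b.
    by move: h; rewrite -/k1 k10 scaler0 add0r.
  + have := coefs 0 a; rewrite scale0r add0r => h /h[_ h1]; exact: h1.
  + by split=> //; exists z2.
- move=> mp np; have [|a b|dim span] := @cohomology_span2 _ _ _ _ z1 z2.
  + exact: dec.
  + by move=> /coefs[h1 h2]; split; [exact: h1|exact: h2].
  + by split=> //; exists z1, z2.
Qed.
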